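(* Let $V:\mathbb{R}\to\mathbb{R}$ satisfy $V\in W^{2,\infty}(\mathbb{R})\cap L^2(\mathbb{R})$ and let $s\in\mathbb{R}$ be a simple root of $\mathcal{V}'$, where $\mathcal{V}(s)=\int_{\mathbb{R}}V(x+s)\,\mathrm{sech}^2(x)\,dx$. There exists $\varepsilon_0>0$ such that for every $\varepsilon\in(-\varepsilon_0,\varepsilon_0)$ there exists a real solution of the equation $$\phi_\varepsilon''+2(1-|\phi_\varepsilon|^2)\phi_\varepsilon=\varepsilon V(x)\phi_\varepsilon$$ in the form $\phi_\varepsilon=\varphi_s+\tilde\varphi_\varepsilon$, where $\varphi_s(x)=\varphi(x-s)$ with $\varphi(x)=\tanh(x)$, and $\tilde\varphi_\varepsilon\in H^2(\mathbb{R})$ satisfies $\|\tilde\varphi_\varepsilon\|_{H^2}\le C|\varepsilon|$ for some $\varepsilon$-independent positive constant $C$. *)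

(* Defs.v *)
From mathcomp Require Import all_boot all_order all_algebra.
From mathcomp Require Import all_classical all_reals all_analysis.

Set Implicit Arguments.
Unset Strict Implicit.
Unset Printing Implicit Defensive.

Import Order.TTheory GRing.Theory Num.Theory.
Import numFieldNormedType.Exports.

Local Open Scope ring_scope.
Local Open Scope classical_set_scope.

Definition cosh (R : realType) (x : R) : R := (expR x + expR (- x)) / 2.
Definition sinh (R : realType) (x : R) : R := (expR x - expR (- x)) / 2.
Definition tanh (R : realType) (x : R) : R := sinh x / cosh x.
Definition sech (R : realType) (x : R) : R := (cosh x)^-1.

Definition test_function (R : realType) (h : R -> R) : Prop :=
  (forall n x, derivable h^`(n) x 1) /\ compact (closure [set x | h x != 0]).

(* Local integrability is required explicitly because [Rintegral] is total. *)
Definition weak_derivative (R : realType) (k : nat) (f g : R -> R) : Prop :=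
  [/\ locally_integrable setT f, locally_integrable setT g &
    forall h : R -> R, test_function h ->
      \int[lebesgue_measure]_x (f x * (h^`(k))%classic x) =
      (-1) ^+ k * \int[lebesgue_measure]_x (g x * h x)].

(* D 0, ..., D n are representatives of the weak derivatives of orders
   0, ..., n of f, all of them in L^p; D k is unconstrained for k > n. *)
Definition weak_jet (R : realType) (n : nat) (p : \bar R) (f : R -> R)
    (D : nat -> R -> R) : Prop :=
  D 0%N = f /\
  forall k, (k <= n)%N ->
    D k \in Lfun lebesgue_measure p /\ weak_derivative k f (D k).

(* f belongs to W^{n,p}(R). *)
Definition sobolev (R : realType) (n : nat) (p : \bar R) (f : R -> R) : Prop :=
  exists D, weak_jet n p f D.

(* Norm of H^n(R) = W^{n,2}(R).  Weak derivatives are unique up to a null set,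
   so the infimum is over a single value when f is in H^n(R); otherwise it is
   over the empty set, and the norm is +oo. *)
Definition Hnorm (R : realType) (n : nat) (f : R -> R) : \bar R :=
  ereal_inf [set ((\sum_(k < n.+1)
                     'N[lebesgue_measure]_2%:E[EFin \o D k] `^ 2) `^ 2^-1)%E
            | D in weak_jet n 2%:E f].

Definition effective_potential (R : realType) (V : R -> R) (s : R) : R :=
  \int[lebesgue_measure]_x (V (x + s) * sech x ^+ 2).

Definition simple_root (R : realType) (f : R -> R) (s : R) : Prop :=
  [/\ f s = 0, derivable f s 1 & f^`() s != 0].

(* phi'' + 2 (1 - |phi|^2) phi = eps V phi, where phi'' is the weak second
   derivative and the equality holds almost everywhere. *)
Definition stationary_solution (R : realType) (V : R -> R) (eps : R)
    (phi : R -> R) : Prop :=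
  exists2 phi2 : R -> R, weak_derivative 2 phi phi2 &
    {ae lebesgue_measure, forall x,
      phi2 x + 2 * (1 - `|phi x| ^+ 2) * phi x = eps * V x * phi x}.

(* Main.v *)
Require Import Defs.
From mathcomp Require Import all_boot all_order all_algebra.
From mathcomp Require Import all_classical all_reals all_analysis.
From mathcomp Require Import measurable_realfun ess_sup_inf.
From mathcomp Require Import ring lra.

Import Order.TTheory GRing.Theory Num.Theory.
Import numFieldNormedType.Exports.

Local Open Scope ring_scope.
Local Open Scope classical_set_scope.

Set Implicit Arguments.
Unset Strict Implicit.

(** Write T(x) = tanh(x - s) and psi = T' = sech^2(x - s), and look for the
solution as phi = T + eps u.  The equation becomes

  L u = - V T - eps N(u),   L = - d^2/dx^2 + 4 - 6 psi,
  N(u) = 6 T u^2 + 2 eps u^3 + V u,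

and L annihilates psi, the trace of translation invariance.  Hence the right
side has to be orthogonal to psi.  To leading order this says that V T psi has
zero integral, which is the vanishing of the first derivative of the effective
potential at s; what remains is the scalar equation that psi N(u) has zero
integral.

Let v solve L v = - V T, let eps = sg dl^2, and write u = v + b psi + dl r.
The equation for r is L r = - sg dl N(u), and the scalar equation reads
offset + slope b + O(dl) = 0: the coefficient of b^2 is the integral of 6 T
psi^3, zero because the integrand is a derivative, and slope is the integral
of 12 T psi^2 v + V psi^2.  The virial identity (virial_identity), which
expresses that psi' solves L psi' = - 12 T psi^2, turns slope into the
integral of V (T psi)', a nonzero multiple of the second derivative of the
effective potential.  So (b, r) is a fixed point of a map whose Lipschitz
constant is O(dl); the splitting of eps into dl times dl is what gives a small
factor to both equations at once.  This is perturbed_solution.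

The inverse of L is explicit.  The substitution u = psi z turns L u = f into
(psi^2 z')' = - psi f, so z' = flux / psi^2, where flux(y) is the integral of
psi f over (y, +oo) or minus the integral over (-oo, y]: the two agree when
psi f has zero integral.  The half line that avoids s is the one used, so that
the bounds hold for every f; the equation L u = f needs the zero integral.

All estimates are pointwise, against the weight
m(y) = (integral of exp(-|t-y|) V(t)^2 dt + exp(-|y-s|))^(1/2).  Since
m(y) <= exp(|x-y|) m(x), kernels of decay exp(-2|x-y|) preserve the bound
|f| <= A m; and m is square integrable by Tonelli's theorem, so that the
pointwise bounds on u, u' and u'' give the bound in H^2.  The Picard iteration
therefore runs on functions, without a normed space of them.

The potential is merely bounded and measurable once it has been modified on a
null set, so u'' need not be continuous.  Derivatives are handled as pairs
(F, f) in which F is the indefinite integral of a locally bounded measurable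
f; the product rule for such pairs yields weak derivatives, the differential
equations of L, and the vanishing of integrals of derivatives. *)

Local Notation mu := lebesgue_measure.

(** * Integrals of real-valued functions *)

Section integrability.
Context d (T : measurableType d) {R : realType}.
Variable mu : {measure set T -> \bar R}.
Implicit Types (f g : T -> R) (D : set T).

Lemma dominated_integrable D f g : measurable D -> measurable_fun D f ->
  (forall x, D x -> `|f x| <= g x) ->
  mu.-integrable D (EFin \o g) -> mu.-integrable D (EFin \o f).
Proof.
move=> mD mf fg; apply: le_integrable => //; first exact/measurable_EFinP.
by move=> x Dx /=; rewrite lee_fin (le_trans (fg x Dx))// ler_norm.
Qed.

Lemma integrable_scale D k f : measurable D -> mu.-integrable D (EFin \o f) ->
  mu.-integrable D (EFin \o (fun x => k * f x)).
Proof.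
move=> mD fi; have := integrableZl mD k fi.
by apply: eq_integrable => // x _.
Qed.

Lemma integrable_add D f g : measurable D -> mu.-integrable D (EFin \o f) ->
  mu.-integrable D (EFin \o g) ->
  mu.-integrable D (EFin \o (fun x => f x + g x)).
Proof.
move=> mD fi gi; have := integrableD mD fi gi.
by apply: eq_integrable => // x _.
Qed.

Lemma integrable_measurable D f : mu.-integrable D (EFin \o f) ->
  measurable_fun D f.
Proof. by move=> /integrableP[/measurable_EFinP]. Qed.

Lemma norm_Rintegral_le D f g : measurable D -> measurable_fun D f ->
  (forall x, D x -> `|f x| <= g x) ->
  mu.-integrable D (EFin \o g) ->
  `|\int[mu]_(x in D) f x| <= \int[mu]_(x in D) g x.
Proof.
move=> mD mf fg gi; have fi := dominated_integrable mD mf fg gi.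
apply: (le_trans (le_normr_Rintegral mD fi)).
by apply: le_Rintegral => //; exact: integrable_norm.
Qed.

End integrability.

(** * Indefinite integrals of locally bounded functions *)

Section primitives.
Context {R : realType}.
Implicit Types (f g F G : R -> R) (a b c C : R).

Definition locally_bounded f :=
  forall r, exists C, forall x, `|x| <= r -> `|f x| <= C.

(** The differentiable functions of this development: unlike a classical
    derivative, [f] may be discontinuous, and unlike an almost everywhere
    derivative it determines the increments of [F]. *)
Definition primitive F f := [/\ measurable_fun setT f, locally_bounded f &
  forall a b, a <= b -> \int[mu]_(t in `[a, b]) f t = F b - F a].

Lemma bounded_locally f C : (forall x, `|f x| <= C) -> locally_bounded f.
Proof. by move=> fC r; exists C. Qed.

Lemma continuous_locally_bounded f : continuous f -> locally_bounded f.
Proof.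
move=> cf r.
have cK : compact (f @` `[- r, r]).
  apply: continuous_compact; last exact: segment_compact.
  exact: continuous_subspaceT.
have [M [_ HM]] := compact_bounded cK.
exists (M + 1) => x xr; apply: (HM (M + 1)); first by rewrite ltrDl.
by exists x => //; rewrite /= in_itv/= -ler_norml.
Qed.

Lemma locally_boundedD f g : locally_bounded f -> locally_bounded g ->
  locally_bounded (fun x => f x + g x).
Proof.
move=> bf bg r; have [C HC] := bf r; have [D HD] := bg r.
exists (C + D) => x xr; apply: (le_trans (ler_normD _ _)).
by apply: lerD; [exact: HC|exact: HD].
Qed.

Lemma locally_boundedM f g : locally_bounded f -> locally_bounded g ->
  locally_bounded (fun x => f x * g x).
Proof.
move=> bf bg r; have [C HC] := bf r; have [D HD] := bg r.
exists (C * D) => x xr; rewrite normrM.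
by apply: ler_pM; [by []|by []|exact: HC|exact: HD].
Qed.

Lemma locally_bounded_itv f a b : locally_bounded f ->
  exists2 C, 0 <= C & forall x, a <= x <= b -> `|f x| <= C.
Proof.
move=> /(_ (Num.max `|a| `|b|))[C HC]; exists (Num.max 0 C).
  by rewrite le_max lexx.
move=> x /andP[ax xb]; rewrite le_max; apply/orP; right; apply: HC.
rewrite ler_norml; apply/andP; split.
  rewrite (le_trans _ ax)// lerNl le_max -normrN ler_norm//.
by rewrite (le_trans xb)// le_max ler_norm orbT.
Qed.

Lemma itv_bounded_integrable f a b : measurable_fun setT f -> locally_bounded f ->
  mu.-integrable `[a, b] (EFin \o f).
Proof.
move=> mf bf; apply: measurable_bounded_integrable => //.
- by rewrite /= lebesgue_measure_itv/=; case: ifP => //; rewrite ltry.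
- exact: measurable_funTS.
- have [C C0 HC] := locally_bounded_itv a b bf.
  exists C; split; first exact: num_real.
  move=> y Cy x /=; rewrite in_itv/= => xab.
  by rewrite (le_trans (HC _ xab))// ltW.
Qed.

Lemma Rintegral_itv_split f a b c : measurable_fun setT f -> locally_bounded f ->
  a <= b -> b <= c ->
  \int[mu]_(t in `[a, c]) f t =
  \int[mu]_(t in `[a, b]) f t + \int[mu]_(t in `[b, c]) f t.
Proof.
move=> mf bf ab bc; have fi := itv_bounded_integrable a c mf bf.
have := @Rintegral_itvB R f (BLeft a) (BRight c) b fi.
rewrite !bnd_simp => /(_ ab bc).
rewrite Rintegral_itv_obnd_cbnd; last first.
  apply: integrableS (itv_bounded_integrable b c mf bf) => //.
  by apply: subset_itvr; rewrite bnd_simp.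
by move=> <-; rewrite addrC subrK.
Qed.

Lemma Rintegral_itv_le f a b C : a <= b -> measurable_fun setT f ->
  (forall x, a <= x <= b -> `|f x| <= C) ->
  `|\int[mu]_(t in `[a, b]) f t| <= C * (b - a).
Proof.
move=> ab mf fC.
have mab : (mu `[a, b] < +oo)%E.
  by rewrite /= lebesgue_measure_itv/=; case: ifP => //; rewrite ltry.
apply: le_trans.
  apply: (norm_Rintegral_le (g := fun=> C)) => //.
  - exact: measurable_funTS.
  - by apply: itv_bounded_integrable => //; exact: (@bounded_locally _ `|C|).
rewrite Rintegral_cst//= lebesgue_measure_itv/= lte_fin.
case: ifPn => //=; rewrite -leNgt => ba.
by rewrite (_ : b = a) ?subrr//; apply/eqP; rewrite eq_le ba.
Qed.

(** Cutting [a, b] into n pieces bounds the total increment by n times a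
    multiple of 1/n^2. *)
Lemma quadratic_increments_constant (D : R -> R) a b K : a <= b ->
  (forall x y, a <= x -> x <= y -> y <= b -> `|D y - D x| <= K * (y - x) ^+ 2) ->
  D b = D a.
Proof.
move=> ab HD.
have H n : `|D b - D a| <= K * (b - a) ^+ 2 / n.+1%:R.
  pose x (i : nat) := a + (b - a) * (i%:R / n.+1%:R).
  have x0 : x 0%N = a by rewrite /x mul0r mulr0 addr0.
  have xn : x n.+1 = b by rewrite /x divff ?pnatr_eq0// mulr1 addrC subrK.
  have xS i : x i.+1 - x i = (b - a) / n.+1%:R.
    by rewrite /x (_ : i.+1%:R = i%:R + 1 :> R) ?natr1//; ring.
  have step : 0 <= (b - a) / n.+1%:R by rewrite divr_ge0// subr_ge0.
  have xle i : x i <= x i.+1 by rewrite -subr_ge0 xS.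
  have xmon i j : (i <= j)%N -> x i <= x j.
    by move=> ij; apply: (homo_leq (f := x) (r := <=%R)) => //; exact: le_trans.
  rewrite -{1}xn -{1}x0 -(telescope_sumr (D \o x)) //.
  apply: (le_trans (ler_norm_sum _ _ _)).
  apply: (@le_trans _ _ (\sum_(0 <= i < n.+1) (K * ((b - a) / n.+1%:R) ^+ 2))).
    rewrite big_nat [leRHS]big_nat; apply: ler_sum => i /andP[_ i_n].
    by rewrite /= -(xS i); apply: HD => //; [rewrite -x0 xmon|rewrite -xn xmon].
  rewrite sumr_const_nat subn0 -mulr_natr.
  rewrite le_eqVlt; apply/orP; left; apply/eqP.
  have n0 : n.+1%:R != 0 :> R by rewrite pnatr_eq0.
  by set m := n.+1%:R in n0 *; field.
apply/eqP; rewrite -subr_eq0 -normr_le0 leNgt; apply/negP => D0.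
set d := `|_| in D0 H; set k := K * _ in H.
have [n Hn] : exists n : nat, k / d < n%:R.
  by exists (Num.bound `|k / d|); exact: le_lt_trans (ler_norm _) (archi_boundP
    (normr_ge0 _)).
have := H n; rewrite ler_pdivlMr// leNgt; apply/negP/negPn.
rewrite -natr1 mulrDr mulr1; move: Hn; rewrite ltr_pdivrMr// mulrC; lra.
Qed.

Lemma primitive_lipschitz F f a b : primitive F f ->
  exists2 C, 0 <= C & forall x y, a <= x -> x <= y -> y <= b ->
    `|F y - F x| <= C * (y - x).
Proof.
move=> [mf bf Ff]; have [C C0 HC] := locally_bounded_itv a b bf.
exists C => // x y ax xy yb; rewrite -Ff//.
apply: Rintegral_itv_le => // z /andP[xz zy]; apply: HC.
by rewrite (le_trans ax)//= (le_trans zy).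
Qed.

Lemma primitive_continuous F f : primitive F f -> continuous F.
Proof.
move=> Ff x; have [C C0 HC] := primitive_lipschitz (x - 1) (x + 1) Ff.
apply/cvgrPdist_le => e e0; near=> y.
have xy : `|x - y| <= 1 by near: y; exact: cvgr_dist_le.
have xye : (C + 1) * `|x - y| <= e.
  rewrite mulrC -ler_pdivlMr; last by rewrite ltr_wpDl.
  by near: y; apply: cvgr_dist_le => //; rewrite divr_gt0// ltr_wpDl.
move: xy; rewrite ler_distl => /andP[xy1 xy2].
apply: le_trans xye; apply: (@le_trans _ _ (C * `|x - y|)); last first.
  by rewrite ler_wpM2r// lerDl.
have [yx|/ltW yx] := leP y x.
  by rewrite (ger0_norm (x:= x-y)) ?subr_ge0//; apply: HC => //; lra.
by rewrite distrC (distrC x) (ger0_norm (x:=y-x)) ?subr_ge0//; apply: HC => //; lra.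
Unshelve. all: by end_near. Qed.

Lemma primitive_locally_bounded F f : primitive F f -> locally_bounded F.
Proof. by move/primitive_continuous/continuous_locally_bounded. Qed.

Lemma primitive_measurable F f : primitive F f -> measurable_fun setT F.
Proof. by move/primitive_continuous/continuous_measurable_fun. Qed.

Lemma eq_primitive F f g : primitive F f -> f =1 g -> primitive F g.
Proof. by move=> + /funext <-. Qed.

Lemma primitiveD F f G g : primitive F f -> primitive G g ->
  primitive (fun x => F x + G x) (fun x => f x + g x).
Proof.
move=> [mf bf Ff] [mg bg Gg]; split.
- exact: measurable_funD.
- exact: locally_boundedD.
- move=> a b ab; rewrite RintegralD//; [|exact: itv_bounded_integrable..].
  by rewrite Ff// Gg//; ring.
Qed.

Lemma primitiveZ k F f : primitive F f ->
  primitive (fun x => k * F x) (fun x => k * f x).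
Proof.
move=> [mf bf Ff]; split.
- exact: measurable_funM.
- by apply: locally_boundedM => //; exact: (@bounded_locally _ `|k|).
- move=> a b ab; rewrite RintegralZl//; last exact: itv_bounded_integrable.
  by rewrite Ff//; ring.
Qed.

(** The integrals of f and g over [x, y] are the increments of F and G, so the
    defect of the formula on [x, y] is the integral of
    f(t) (G(y) - G(t)) + (F(x) - F(t)) g(t).  Both differences are O(y - x), so
    the defect is O((y - x)^2) and quadratic_increments_constant applies. *)
Lemma primitiveM F f G g : primitive F f -> primitive G g ->
  primitive (fun x => F x * G x) (fun x => f x * G x + F x * g x).
Proof.
move=> pF pG; have [mf bf Ff] := pF; have [mg bg Gg] := pG.
have mF := primitive_measurable pF; have mG := primitive_measurable pG.
have bF := primitive_locally_bounded pF; have bG := primitive_locally_bounded pG.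
have mh : measurable_fun setT (fun x => f x * G x + F x * g x).
  by apply: measurable_funD; exact: measurable_funM.
have bh : locally_bounded (fun x => f x * G x + F x * g x).
  by apply: locally_boundedD; exact: locally_boundedM.
split => // a b ab.
have [C C0 HC] := primitive_lipschitz a b pF.
have [D D0 HD] := primitive_lipschitz a b pG.
have [A A0 HA] := locally_bounded_itv a b bf.
have [B B0 HB] := locally_bounded_itv a b bg.
pose Q x := F x * G x - \int[mu]_(t in `[a, x]) (f t * G t + F t * g t).
suff : Q b = Q a.
  rewrite /Q set_itv1 Rintegral_set1; lra.
apply: (@quadratic_increments_constant Q a b (A * D + C * B)) => // x y ax xy yb.
have -> : Q y - Q x =
  \int[mu]_(t in `[x, y]) (f t * (G y - G t) + (F x - F t) * g t).
  rewrite /Q (Rintegral_itv_split mh bh ax xy).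
  have If k : mu.-integrable `[x, y] (EFin \o (fun t => k * f t)).
    by apply: integrable_scale => //; exact: itv_bounded_integrable.
  have Ig k : mu.-integrable `[x, y] (EFin \o (fun t => k * g t)).
    by apply: integrable_scale => //; exact: itv_bounded_integrable.
  transitivity (\int[mu]_(t in `[x, y])
      ((G y * f t + F x * g t) - (f t * G t + F t * g t))); last first.
    by apply: eq_Rintegral => t _; ring.
  rewrite RintegralB//; [|by apply: integrable_add|exact: itv_bounded_integrable].
  have -> : \int[mu]_(t in `[x, y]) (G y * f t + F x * g t) =
      G y * (F y - F x) + F x * (G y - G x).
    rewrite RintegralD// -(Ff _ _ xy) -(Gg _ _ xy).
    by congr (_ + _); apply: RintegralZl => //; exact: itv_bounded_integrable.
  by ring.
have -> : (A * D + C * B) * (y - x) ^+ 2 = (A * (D * (y - x)) + C *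
  (y - x) * B) * (y - x).
  by ring.
apply: Rintegral_itv_le => //.
  apply: measurable_funD; apply: measurable_funM => //.
  - exact: measurable_funB.
  - exact: measurable_funB.
move=> t /andP[xt ty]; apply: (le_trans (ler_normD _ _)); rewrite !normrM.
have tab : a <= t <= b by rewrite (le_trans ax xt) (le_trans ty yb).
apply: lerD; apply: ler_pM => //.
- exact: HA.
- apply: (le_trans (HD t y _ _ _)) => //; first by case/andP: tab.
  by rewrite ler_wpM2l// lerB.
- rewrite distrC; apply: (le_trans (HC x t _ _ _)) => //; first by case/andP: tab.
  by rewrite ler_wpM2l// lerB.
- exact: HB.
Qed.

Lemma primitive_C1 F f : continuous f -> (forall x : R, is_derive x (1 : R) F (f x)) ->
  primitive F f.
Proof.
move=> cf dF; split.
- exact: continuous_measurable_fun.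
- exact: continuous_locally_bounded.
- move=> a b; rewrite le_eqVlt => /predU1P[->|ab].
    by rewrite set_itv1 Rintegral_set1 subrr.
  have cF : continuous F.
    by move=> x; apply/differentiable_continuous/derivable1_diffP; case: (dF x).
  rewrite /Rintegral (@continuous_FTC2 _ f F)//.
  + exact: continuous_subspaceT.
  + split => [x _||]; first by case: (dF x).
      by apply: cvg_at_right_filter; exact: cF.
    by apply: cvg_at_left_filter; exact: cF.
  + by move=> x _; rewrite derive1E; case: (dF x).
Qed.

(** One of the two integrals is over an empty set or a point, so this is the
    integral from [s] to [x] with its sign. *)
Definition oriented_integral (s : R) f x :=
  \int[mu]_(t in `[s, x]) f t - \int[mu]_(t in `[x, s]) f t.

Lemma Rintegral_itv_empty f a b : b <= a -> \int[mu]_(t in `[a, b]) f t = 0.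
Proof.
rewrite le_eqVlt => /predU1P[->|ba]; first by rewrite set_itv1 Rintegral_set1.
by rewrite set_itv_ge ?Rintegral_set0// bnd_simp -ltNge.
Qed.

Lemma primitive_oriented_integral s f : measurable_fun setT f -> locally_bounded f ->
  primitive (oriented_integral s f) f.
Proof.
move=> mf bf; split => // a b ab; rewrite /oriented_integral.
have [sa|/ltW as_] := leP s a.
  rewrite (Rintegral_itv_empty _ (le_trans sa ab)) (Rintegral_itv_empty _ sa).
  by rewrite (Rintegral_itv_split mf bf sa ab); ring.
rewrite (Rintegral_itv_empty _ as_).
have [sb|/ltW bs] := leP s b.
  by rewrite (Rintegral_itv_empty _ sb) (Rintegral_itv_split mf bf as_ sb); ring.
by rewrite (Rintegral_itv_empty _ bs) (Rintegral_itv_split mf bf ab bs); ring.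
Qed.

End primitives.

(** * Integrals of derivatives and weak derivatives *)

Section vanishing.
Context {R : realType}.
Implicit Types (f g F G : R -> R) (a b c C : R).

Definition vanishing F :=
  forall e, 0 < e -> exists N, forall x, N <= `|x| -> `|F x| <= e.

(** The integral over [-n, n] is F(n) - F(-n), and it converges to the integral
    over the line by dominated convergence. *)
Lemma primitive_integral0 F f : primitive F f ->
  mu.-integrable setT (EFin \o f) -> vanishing F -> \int[mu]_x f x = 0.
Proof.
move=> [mf bf Ff] fi F0.
pose fn (n : nat) x := (f \_ `[- n%:R, n%:R]) x.
have mfn n : measurable_fun setT (fn n).
  by apply/(measurable_restrictT _ _).1 => //; exact: measurable_funTS.
have cvgI : (\int[mu]_x (fn n x)%:E @[n --> \oo] --> \int[mu]_x (f x)%:E)%E.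
  apply: (@dominated_cvg _ _ _ mu setT measurableT (fun n x => (fn n x)%:E)
            (fun x => (f x)%:E) (fun x => `|(f x)%:E|%E)).
  - by move=> n; apply/measurable_EFinP; exact: mfn.
  - move=> x _; apply: cvg_near_cst; near=> n.
    rewrite /fn patchE ifT// inE/= in_itv/= -ler_norml.
    by near: n; exact: nbhs_infty_ger.
  - by [].
  - exact: (integrable_norm fi).
  - move=> n x _; rewrite /fn patchE; case: ifP => _ //.
    by rewrite lee_fin normr0.
have Ifn n : (\int[mu]_x (fn n x)%:E = (F n%:R - F (- n%:R))%:E)%E.
  rewrite -Ff ?ge0_cp// /Rintegral fineK; last first.
    by apply: integrable_fin_num => //; exact: itv_bounded_integrable.
  by rewrite [RHS]integral_mkcond restrict_EFin.
apply/eqP; rewrite -normr_le0; apply/ler_addgt0Pr => e e0; rewrite add0r.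
have e2 : 0 < e / 2 by rewrite divr_gt0.
have [N HN] := F0 _ e2.
have Lim : F n%:R - F (- n%:R) @[n --> \oo] --> \int[mu]_x f x.
  have fK : (\int[mu]_x (f x)%:E = (\int[mu]_x f x)%:E)%E.
    by rewrite /Rintegral fineK//; exact: integrable_fin_num.
  move: cvgI; rewrite fK; under eq_fun do rewrite Ifn.
  by move/fine_cvg.
rewrite -(cvg_lim _ (cvg_norm Lim))//.
apply: limr_le; first by apply/cvg_ex; eexists; exact: cvg_norm Lim.
near=> n.
have Nn : N <= n%:R by near: n; exact: nbhs_infty_ger.
rewrite (le_trans (ler_normB _ _))// (splitr e) lerD//; apply: HN.
  by rewrite ger0_norm.
by rewrite normrN ger0_norm.
Unshelve. all: by end_near. Qed.

Definition supported f N := forall x, N < `|x| -> f x = 0.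

Lemma supported_vanishing F N : supported F N -> vanishing F.
Proof.
move=> FN e e0; exists (N + 1) => x Nx; rewrite FN ?normr0 ?ltW//.
by rewrite (lt_le_trans _ Nx)// ltrDl.
Qed.

Lemma supported_integrable f N : measurable_fun setT f -> locally_bounded f ->
  supported f N -> mu.-integrable setT (EFin \o f).
Proof.
move=> mf bf fN.
have -> : EFin \o f = (EFin \o f) \_ `[- N, N].
  apply/funext => x; rewrite patchE; case: ifPn => //.
  rewrite notin_setE/= in_itv/= -ler_norml => /negP; rewrite -ltNge => Nx.
  by rewrite fN.
apply/integrable_restrict => //; rewrite setTI; exact: itv_bounded_integrable.
Qed.

(** The derivative of the product F G, which vanishes near infinity, has zero
    integral. *)
Lemma primitive_parts F f G g N : primitive F f -> primitive G g ->
  supported G N -> supported g N ->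
  \int[mu]_x (F x * g x) = - \int[mu]_x (f x * G x).
Proof.
move=> pF pG GN gN; have [mf bf _] := pF; have [mg bg _] := pG.
have mF := primitive_measurable pF; have mG := primitive_measurable pG.
have bF := primitive_locally_bounded pF; have bG := primitive_locally_bounded pG.
have I1 : mu.-integrable setT (EFin \o (fun x => f x * G x)).
  apply: (@supported_integrable _ N); first exact: measurable_funM.
    exact: locally_boundedM.
  by move=> x /GN ->; rewrite mulr0.
have I2 : mu.-integrable setT (EFin \o (fun x => F x * g x)).
  apply: (@supported_integrable _ N); first exact: measurable_funM.
    exact: locally_boundedM.
  by move=> x /gN ->; rewrite mulr0.
apply/eqP; rewrite -addr_eq0 addrC; apply/eqP.
rewrite -RintegralD//; apply: (primitive_integral0 (primitiveM pF pG)).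
  exact: integrable_add.
by apply: (@supported_vanishing _ N) => x /GN ->; rewrite mulr0.
Qed.

Lemma locally_integrable_bounded f : measurable_fun setT f ->
  locally_bounded f -> locally_integrable setT f.
Proof.
move=> mf bf; split => //; first exact: openT.
move=> K _ cK.
have [M [_ HM]] := compact_bounded cK.
have : mu.-integrable `[- (M + 1), M + 1] (EFin \o f) by exact: itv_bounded_integrable.
move=> /integrableP[_]; apply: le_lt_trans.
apply: ge0_subset_integral => //=.
- exact: compact_measurable.
- by apply/measurable_EFinP/measurable_funTS; exact: measurableT_comp.
- by move=> x Kx /=; rewrite in_itv/= -ler_norml; apply: (HM (M + 1)); rewrite ?ltrDl.
Qed.

(** Outside a ball that contains the support the function vanishes on a
    neighbourhood of each point, and so does every derivative; one radius
    serves all orders. *)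
Lemma test_function_supported (h : R -> R) : test_function h ->
  exists N, forall n, supported (h^`(n))%classic N.
Proof.
move=> [dh ch].
have [M [_ HM]] := compact_bounded ch.
exists (M + 1); elim=> [|n IH] x Mx /=.
  apply/eqP/negPn/negP => hx; move: Mx; rewrite ltNge; apply/negP/negPn.
  by apply: (HM (M + 1)); rewrite ?ltrDl//; apply: subset_closure.
rewrite derive1E -/(derive1n n h) (@near_eq_derive _ _ _ _ (cst 0)) ?derive_cst//.
near=> y; apply: IH.
by near: y; apply: (cvgr_gt `|x|) => //; apply: cvg_norm; exact: cvg_id.
Unshelve. all: by end_near. Qed.

Lemma test_function_primitive (h : R -> R) n : test_function h ->
  primitive (h^`(n))%classic (h^`(n.+1))%classic.
Proof.
move=> [dh _]; apply: primitive_C1.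
  by move=> x; exact/differentiable_continuous/derivable1_diffP.
by move=> x; apply: DeriveDef => //; rewrite derive1nS derive1E.
Qed.

Lemma weak_derivative0 F : measurable_fun setT F -> locally_bounded F ->
  weak_derivative 0 F F.
Proof.
move=> mF bF; have := locally_integrable_bounded mF bF.
by split => // h _; rewrite expr0 mul1r.
Qed.

Lemma weak_derivative1 F f : primitive F f -> weak_derivative 1 F f.
Proof.
move=> pF; have [mf bf _] := pF; split.
- apply: locally_integrable_bounded; first exact: primitive_measurable pF.
  exact: primitive_locally_bounded pF.
- exact: locally_integrable_bounded.
- move=> h th; have [N hN] := test_function_supported th.
  rewrite expr1 mulN1r.
  exact: (primitive_parts pF (test_function_primitive 0 th) (hN 0%N) (hN 1%N)).
Qed.

(** Two integrations by parts, the first one against the derivative of the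
    test function. *)
Lemma weak_derivative2 F f g : primitive F f -> primitive f g ->
  weak_derivative 2 F g.
Proof.
move=> pF pf; have [mg bg _] := pf; split.
- apply: locally_integrable_bounded; first exact: primitive_measurable pF.
  exact: primitive_locally_bounded pF.
- exact: locally_integrable_bounded.
- move=> h th; have [N hN] := test_function_supported th.
  rewrite sqrrN expr1n mul1r.
  rewrite (primitive_parts pF (test_function_primitive 1 th) (hN 1%N) (hN 2%N)).
  rewrite (primitive_parts pf (test_function_primitive 0 th) (hN 0%N) (hN 1%N)).
  by rewrite opprK.
Qed.

End vanishing.

(** * Translation invariance *)

Section translation.
Context {R : realType}.
Local Open Scope ereal_scope.

Lemma lebesgue_measure_shift (a : R) (A : set R) : measurable A ->
  pushforward mu ((fun x => x + a)%R : _ -> measurableTypeR R) A = mu A.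
Proof.
move=> mA; apply/esym/lebesgue_measure_unique => //= [|_ _ [[b c]] _ <-].
  exact: measurable_funD.
rewrite /pushforward.
have -> : (fun x : R => x + a)%R @^-1` `]b, c] = `](b - a)%R, (c - a)%R]%classic.
  by apply/seteqP; split => x /=; rewrite !in_itv/= ltrBlDr lerBrDr.
rewrite !lebesgue_measure_itv/= !lte_fin ltrD2r; case: ifP => // _.
by rewrite -!EFinB; congr EFin; ring.
Qed.

Lemma integral_shift (f : R -> \bar R) (a : R) : measurable_fun setT f ->
  \int[mu]_x f (x + a)%R = \int[mu]_x f x.
Proof.
have ge0 (g : R -> \bar R) : measurable_fun setT g -> (forall x, 0 <= g x) ->
    \int[mu]_x g (x + a)%R = \int[mu]_x g x.
  move=> mg g0.
  transitivity (\int[pushforward mu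
      ((fun x => x + a)%R : _ -> measurableTypeR R)]_x g x).
    by rewrite ge0_integral_pushforward//; exact: measurable_funD.
  apply: eq_measure_integral => [|mphi A mA _]; first exact: measurable_funD.
  exact: lebesgue_measure_shift.
move=> mf; rewrite integralE [RHS]integralE.
congr (_ - _).
- rewrite -(ge0 _ (measurable_funepos mf) (funepos_ge0 f)).
  by apply: eq_integral => x _; rewrite !funeposE.
- rewrite -(ge0 _ (measurable_funeneg mf) (funeneg_ge0 f)).
  by apply: eq_integral => x _; rewrite !funenegE.
Qed.

Lemma Rintegral_shift (f : R -> R) (a : R) : measurable_fun setT f ->
  (\int[mu]_x f (x + a)%R = \int[mu]_x f x)%R.
Proof.
move=> mf; rewrite /Rintegral (integral_shift (f := EFin \o f))//.
exact/measurable_EFinP.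
Qed.

End translation.

(** * Hyperbolic functions *)

Section hyperbolic.
Context {R : realType}.
Implicit Types x y : R.

Lemma cosh_gt0 x : 0 < cosh x.
Proof. by rewrite /cosh divr_gt0// addr_gt0// expR_gt0. Qed.

Lemma sech_gt0 x : 0 < sech x.
Proof. by rewrite /sech invr_gt0 cosh_gt0. Qed.

Lemma cosh2_sinh2 x : cosh x ^+ 2 - sinh x ^+ 2 = 1.
Proof.
have : expR x * expR (- x) = 1 by rewrite expRN divff// gt_eqF// expR_gt0.
by rewrite /cosh /sinh => e; lra.
Qed.

Lemma tanh2 x : tanh x ^+ 2 = 1 - sech x ^+ 2.
Proof.
have c0 : cosh x != 0 by rewrite gt_eqF// cosh_gt0.
have -> : tanh x ^+ 2 = sinh x ^+ 2 / cosh x ^+ 2 by rewrite /tanh; field.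
have -> : sinh x ^+ 2 = cosh x ^+ 2 - 1 by have := cosh2_sinh2 x; lra.
by rewrite /sech; field.
Qed.

Lemma expR_le_cosh x : expR `|x| <= 2 * cosh x.
Proof.
rewrite /cosh; have := expR_gt0 x; have := expR_gt0 (- x).
by case: (ger0P x) => _; lra.
Qed.

Lemma cosh_le_expR x : cosh x <= expR `|x|.
Proof.
have : expR x <= expR `|x| by rewrite ler_expR ler_norm.
have : expR (- x) <= expR `|x| by rewrite ler_expR -normrN ler_norm.
by rewrite /cosh; lra.
Qed.

Lemma sech2_ge x : expR (- (2 * `|x|)) <= sech x ^+ 2.
Proof.
rewrite /sech exprVn expRN lef_pV2 ?posrE ?exprn_gt0 ?expR_gt0 ?cosh_gt0//.
rewrite mulrDl mul1r expRD -expr2; apply: lerXn2r.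
- by rewrite nnegrE ltW// cosh_gt0.
- by rewrite nnegrE expR_ge0.
- exact: cosh_le_expR.
Qed.

Lemma sech2_le x : sech x ^+ 2 <= 4 * expR (- (2 * `|x|)).
Proof.
rewrite /sech exprVn expRN -[4]invrK -invfM mulrC lef_pV2; last 2 first.
- by rewrite posrE exprn_gt0// cosh_gt0.
- by rewrite posrE divr_gt0// expR_gt0.
rewrite mulrDl mul1r expRD -expr2.
rewrite ler_pdivrMr// mulrC.
have -> : 4 * cosh x ^+ 2 = (2 * cosh x) ^+ 2 by ring.
apply: lerXn2r.
- by rewrite nnegrE expR_ge0.
- by rewrite nnegrE mulr_ge0// ltW// cosh_gt0.
- exact: expR_le_cosh.
Qed.

Lemma sech2_le1 x : sech x ^+ 2 <= 1.
Proof. by have := tanh2 x; have := sqr_ge0 (tanh x); lra. Qed.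

Lemma tanh_le1 x : `|tanh x| <= 1.
Proof.
rewrite -sqrtr_sqr -sqrtr1 ler_wsqrtr// tanh2.
by rewrite lerBlDr lerDl sqr_ge0.
Qed.

Lemma is_derive_add (f g : R -> R) x a b : is_derive x (1 : R) f a ->
  is_derive x (1 : R) g b -> is_derive x (1 : R) (fun t => f t + g t) (a + b).
Proof. by move=> df dg; exact: is_deriveD. Qed.

Lemma is_derive_mul (f g : R -> R) x a b : is_derive x (1 : R) f a ->
  is_derive x (1 : R) g b ->
  is_derive x (1 : R) (fun t => f t * g t) (a * g x + f x * b).
Proof.
move=> df dg; have dfg := is_deriveM df dg; apply: is_derive_eq.
by rewrite addrC /GRing.scale/=; congr (_ + _); rewrite mulrC.
Qed.

Lemma is_derive_scale (k : R) (f : R -> R) x a : is_derive x (1 : R) f a ->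
  is_derive x (1 : R) (fun t => k * f t) (k * a).
Proof. by move=> df; exact: is_deriveZ. Qed.

Lemma is_derive_compose (f g : R -> R) x a b : is_derive (g x) (1 : R) f a ->
  is_derive x (1 : R) g b -> is_derive x (1 : R) (fun t => f (g t)) (a * b).
Proof. by move=> df dg; exact: is_derive1_comp. Qed.

Lemma is_derive_recenter (f : R -> R) s x a : is_derive (x - s) (1 : R) f a ->
  is_derive x (1 : R) (fun t => f (t - s)) a.
Proof.
move=> df; rewrite -[a]mulr1; apply: (@is_derive_compose f (fun t => t - s)) => //.
by apply: is_derive_eq; rewrite subr0.
Qed.

Lemma is_derive_reflect (f : R -> R) s x a : is_derive (s - x) (1 : R) f a ->
  is_derive x (1 : R) (fun t => f (s - t)) (- a).
Proof.
move=> df; rewrite -[a]mulr1 -mulrN; apply: (@is_derive_compose f (fun t =>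
  s - t)) => //.
have d := is_derive_add (is_derive_cst s x (1 :
  R)) (is_derive_scale (-1) (is_derive_id x (1 : R))).
rewrite (_ : (fun t => s - t) = fun t => s + -1 * t); last first.
  by apply/funext => t; rewrite mulN1r.
by apply: is_derive_eq; rewrite mulr1 add0r.
Qed.

Lemma is_derive_expRN x : is_derive x (1 : R) (fun t => expR (- t)) (- expR (- x)).
Proof.
have d := @is_derive_reflect expR 0 x (expR (0 - x)) (is_derive_expR _).
rewrite (_ : (fun t => _) = fun t => expR (0 - t)); last first.
  by apply/funext => t; rewrite sub0r.
by apply: is_derive_eq; rewrite sub0r.
Qed.

Lemma is_derive_sinh x : is_derive x (1 : R) (@sinh R) (cosh x).
Proof.
have d := is_derive_scale 2^-1 (is_derive_add (is_derive_expR x)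
  (is_derive_scale (-1) (is_derive_expRN x))).
rewrite (_ : @sinh R = fun t => 2^-1 * (expR t + -1 * expR (- t))); last first.
  by apply/funext => t; rewrite /sinh; lra.
by apply: is_derive_eq; rewrite /cosh; lra.
Qed.

Lemma is_derive_cosh x : is_derive x (1 : R) (@cosh R) (sinh x).
Proof.
have d := is_derive_scale 2^-1 (is_derive_add (is_derive_expR x) (is_derive_expRN x)).
rewrite (_ : @cosh R = fun t => 2^-1 * (expR t + expR (- t))); last first.
  by apply/funext => t; rewrite /cosh; lra.
by apply: is_derive_eq; rewrite /sinh; lra.
Qed.

Lemma is_derive_sech x : is_derive x (1 : R) (@sech R) (- tanh x * sech x).
Proof.
have c0 : cosh x != 0 by rewrite gt_eqF// cosh_gt0.
have d := is_deriveV c0 (is_derive_cosh x).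
by apply: is_derive_eq; rewrite /GRing.scale/= /tanh /sech; field.
Qed.

Lemma is_derive_tanh x : is_derive x (1 : R) (@tanh R) (sech x ^+ 2).
Proof.
have c0 : cosh x != 0 by rewrite gt_eqF// cosh_gt0.
have d := is_derive_mul (is_derive_sinh x) (is_derive_sech x).
apply: is_derive_eq; rewrite /tanh /sech.
have := cosh2_sinh2 x; set c := cosh x in c0 *; set k := sinh x => e.
have -> : c * c^-1 + k * (- (k / c) * c^-1) = (c ^+ 2 - k ^+ 2) / c ^+ 2 by field.
by rewrite e div1r exprVn.
Qed.

Lemma is_derive_sech2 x :
  is_derive x (1 : R) (fun t => sech t ^+ 2) (- 2 * tanh x * sech x ^+ 2).
Proof.
have d := is_derive_mul (is_derive_sech x) (is_derive_sech x).
by apply: is_derive_eq; ring.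
Qed.

Lemma is_derive_tanh_sech2 x :
  is_derive x (1 : R) (fun t => tanh t * sech t ^+ 2)
    (sech x ^+ 2 * sech x ^+ 2 - 2 * tanh x ^+ 2 * sech x ^+ 2).
Proof.
have d := is_derive_mul (is_derive_tanh x) (is_derive_sech2 x).
by apply: is_derive_eq; ring.
Qed.

Lemma is_derive_continuous (f df : R -> R) :
  (forall x, is_derive x (1 : R) f (df x)) -> continuous f.
Proof.
move=> d x; apply/differentiable_continuous/derivable1_diffP.
by case: (d x).
Qed.

Lemma continuous_tanh : continuous (@tanh R).
Proof. exact: is_derive_continuous is_derive_tanh. Qed.

Lemma continuous_sech2 : continuous (fun t : R => sech t ^+ 2).
Proof. exact: is_derive_continuous is_derive_sech2. Qed.

End hyperbolic.

(** * The exponential kernel *)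

Section exponential_weight.
Context {R : realType}.
Implicit Types x y t : R.

Lemma continuous_expdist (y : R) : continuous (fun t : R => expR (- `|t - y|)).
Proof.
move=> x; apply: continuous_comp; last exact: continuous_expR.
apply: cvgN; apply: cvg_norm; apply: cvgB; [exact: cvg_id|exact: cvg_cst].
Qed.

(** Translation reduces to y = 0, and evenness to the half line. *)
Lemma integral_expdist (y : R) : (\int[mu]_t (expR (- `|t - y|))%:E = 2%:E)%E.
Proof.
have c0 : continuous (fun t : R => expR (- `|t|)).
  by have := @continuous_expdist 0; under eq_fun do rewrite subr0.
rewrite (@integral_shift R (fun t => (expR (- `|t|))%:E) (- y)); last first.
  by apply/measurable_EFinP; exact: continuous_measurable_fun c0.
rewrite ge0_symfun_integralT//; last by move=> t /=; rewrite normrN.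
rewrite -set_itvcy.
suff -> : (\int[mu]_(x in `[0%R, +oo[) (expR (- `|x : R|))%:E = 1)%E by rewrite mule1.
transitivity (\int[mu]_(x in `[0%R, +oo[) (expR (- x : R))%:E)%E.
  apply: eq_integral => x; rewrite inE/= in_itv/= andbT => x0.
  by rewrite ger0_norm.
rewrite (@ge0_continuous_FTC2y R (fun x => expR (- x)) (fun x => - expR (- x)) 0 0).
- by rewrite oppr0 expR0 sub0e EFinN oppeK.
- by move=> x _; exact: expR_ge0.
- apply: continuous_subspaceT => x; exact: is_derive_continuous is_derive_expRN x.
- rewrite -oppr0; apply: cvgN.
  exact: cvgr_expR.
- move=> x _; have := is_derive_scale (-1) (is_derive_expRN x).
  by under eq_fun do rewrite mulN1r; case.
- apply: cvg_at_right_filter; apply: cvgN; exact: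
    is_derive_continuous is_derive_expRN _.
- move=> x _; rewrite derive1E.
  have := is_derive_scale (-1) (is_derive_expRN x).
  by under eq_fun do rewrite mulN1r; case=> _ ->; rewrite mulN1r opprK.
Qed.

Lemma integrable_expdist (y : R) :
  mu.-integrable setT (EFin \o (fun t => expR (- `|t - y|))).
Proof.
apply/integrableP; split.
  by apply/measurable_EFinP; exact: continuous_measurable_fun (@continuous_expdist y).
under eq_integral do rewrite /= ger0_norm ?expR_ge0//.
by rewrite integral_expdist ltry.
Qed.

Lemma Rintegral_expdist (y : R) : \int[mu]_t expR (- `|t - y|) = 2.
Proof. by rewrite /Rintegral integral_expdist. Qed.

End exponential_weight.

(** * Derivatives of the effective potential *)

Section potential_derivatives.
Context {R : realType}.
Implicit Types x y t : R.

Lemma expdist_integrable_bound (f : R -> R) C y : measurable_fun setT f ->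
  (forall t, `|f t| <= C * expR (- `|t - y|)) ->
  mu.-integrable setT (EFin \o f).
Proof.
move=> mf fC.
apply: (dominated_integrable (g := fun t : measurableTypeR R =>
  C * expR (- `|t - y|))) => //.
by apply: integrable_scale => //; exact: integrable_expdist.
Qed.

Lemma expdist_near x y a : `|x - a| <= 1 ->
  expR (- `|y - x|) <= expR 1 * expR (- `|y - a|).
Proof.
move=> xa; rewrite -expRD ler_expR.
have := ler_distD x y a; lra.
Qed.

Lemma measurable_fun_shift (k : R -> R) a : measurable_fun setT k ->
  measurable_fun setT (fun y => k (y - a)).
Proof. by move=> mk; apply: measurableT_comp => //; exact: measurable_funB. Qed.

(** Differentiation under the integral sign.  For |x - a| <= 1 the bound
    exp(-|y - x|) <= e exp(-|y - a|) provides the dominating function. *)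
Lemma is_derive_correlation (V k k' : R -> R) (B C a : R) : measurable_fun setT V ->
  (forall x, `|V x| <= B) -> (forall x, is_derive x (1 : R) k (k' x)) ->
  continuous k' ->
  (forall x, `|k x| <= C * expR (- `|x|)) ->
  (forall x, `|k' x| <= C * expR (- `|x|)) ->
  is_derive a (1 : R) (fun x => \int[mu]_y (V y * k (y - x)))
    (- \int[mu]_y (V y * k' (y - a))).
Proof.
move=> mV VB dk ck' kC k'C.
have B0 : 0 <= B by exact: le_trans (normr_ge0 _) (VB 0).
have C0 : 0 <= C.
  by have := le_trans (normr_ge0 _) (kC 0); rewrite pmulr_lge0 ?expR_gt0.
have mk : measurable_fun setT k.
  exact: continuous_measurable_fun (is_derive_continuous dk).
have mk' : measurable_fun setT k' by exact: continuous_measurable_fun.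
pose f (x y : R) := V y * k (y - x).
pose G (y : R) := B * C * expR 1 * expR (- `|y - a|).
have dfx x y : is_derive x (1 : R) (f ^~ y) (- (V y * k' (y - x))).
  rewrite /f; have d := is_derive_scale (V y) (is_derive_reflect (dk (y - x))).
  by apply: is_derive_eq; ring.
have d1 x y : partial1of2 f x y = - (V y * k' (y - x)).
  by rewrite /partial1of2 derive1E; case: (dfx x y).
have intf x : (a - 1 < x < a + 1) -> mu.-integrable setT (EFin \o f x).
  move=> _; apply: (@expdist_integrable_bound _ (B * C) x).
    apply: measurable_funM => //; exact: measurable_fun_shift.
  by move=> t; rewrite normrM -[leRHS]mulrA; apply: ler_pM.
have intG : mu.-integrable setT (EFin \o G).
  by apply: integrable_scale => //; exact: integrable_expdist.
have Ia : `]a - 1, a + 1[%classic a by rewrite /= in_itv/=; lra.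
have G0 y : 0 <= G y by rewrite /G !mulr_ge0// expR_ge0.
have Gub x y : `]a - 1, a + 1[%classic x -> setT y -> `|partial1of2 f x y| <= G y.
  rewrite /= in_itv/= => xa _; rewrite d1 normrN normrM /G -2!mulrA.
  apply: ler_pM => //; apply: (le_trans (k'C _)); apply: ler_wpM2l => //.
  by apply: expdist_near; rewrite ler_norml; lra.
have drv x y : `]a - 1, a + 1[%classic x -> setT y -> derivable (f ^~ y) x 1.
  by move=> _ _; case: (dfx x y).
have intf' x : `]a - 1, a + 1[%classic x -> mu.-integrable setT (EFin \o f x).
  by rewrite /= in_itv/=; exact: intf.
have D := derivable_under_integral (mu := mu) measurableT Ia intf' drv G0 intG Gub.
have E := differentiation_under_integral (mu :=
  mu) measurableT Ia intf' drv G0 intG Gub.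
apply: DeriveDef; first exact: D.
rewrite -derive1E E.
rewrite -mulN1r -RintegralZl//; last first.
  apply: (@expdist_integrable_bound _ (B * C) a).
    apply: measurable_funM => //; exact: measurable_fun_shift.
  by move=> t; rewrite normrM -[leRHS]mulrA; apply: ler_pM.
by apply: eq_Rintegral => y _; rewrite d1 mulN1r.
Qed.

Lemma sech2_le_exp x : sech x ^+ 2 <= 4 * expR (- `|x|).
Proof.
apply: (le_trans (sech2_le x)); rewrite ler_wpM2l// ler_expR lerN2.
by rewrite mulrDl mul1r lerDl.
Qed.

(** After the change of variable y = x + a the parameter sits in the smooth
    factor sech^2(y - a) only, so the effective potential can be differentiated
    although V is merely bounded, and V may be replaced by a function equal to
    it almost everywhere. *)
Lemma simple_root_integrals (V V1 : R -> R) (B s : R) :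
  measurable_fun setT V -> measurable_fun setT V1 ->
  {ae mu, forall x, V x = V1 x} -> (forall x, `|V1 x| <= B) ->
  simple_root (effective_potential V)^`() s ->
  \int[mu]_y (V1 y * (tanh (y - s) * sech (y - s) ^+ 2)) = 0 /\
  \int[mu]_y (V1 y * (sech (y - s) ^+ 2 * sech (y - s) ^+ 2 -
     2 * tanh (y - s) ^+ 2 * sech (y - s) ^+ 2)) != 0.
Proof.
move=> mV mV1 VV1 V1B [r0 _ r1].
have c2 := @continuous_sech2 R; have ct := @continuous_tanh R.
have m2 : measurable_fun setT (fun t : R => sech t ^+ 2) by exact:
  continuous_measurable_fun.
have pE : effective_potential V = fun a => \int[mu]_y (V1 y * sech (y - a) ^+ 2).
  apply/funext => a; rewrite /effective_potential.
  transitivity (\int[mu]_y (V y * sech (y - a) ^+ 2)).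
    rewrite -[RHS](@Rintegral_shift _ _ a); last first.
      apply: measurable_funM => //; exact: (measurable_fun_shift a m2).
    by apply: eq_Rintegral => x _; rewrite addrK.
  congr fine; apply: ae_eq_integral => //.
  - apply/measurable_EFinP; apply: measurable_funM => //;
      exact: (measurable_fun_shift a m2).
  - apply/measurable_EFinP; apply: measurable_funM => //;
      exact: (measurable_fun_shift a m2).
  - apply: negligibleS VV1 => x /=.
    by apply: contra_not => Vx _; rewrite Vx.
have s0 (x : R) : 0 <= sech x ^+ 2 by exact: sqr_ge0.
have T1 (x : R) : `|tanh x| <= 1 := tanh_le1 x.
have b1 (x : R) : `|tanh x * sech x ^+ 2| <= 4 * expR (- `|x|).
  rewrite normrM (ger0_norm (s0 x)) -[leRHS]mul1r.
  by apply: ler_pM => //; exact: sech2_le_exp.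
have p1 : (effective_potential V)^`() =
    fun a => 2 * \int[mu]_y (V1 y * (tanh (y - a) * sech (y - a) ^+ 2)).
  apply/funext => a; rewrite pE derive1E.
  have ck : continuous (fun x : R => - 2 * tanh x * sech x ^+ 2).
    move=> x; apply: cvgM; last exact: c2.
    by apply: cvgM; [exact: cvg_cst|exact: ct].
  (* one constant 8 for the kernel and its derivative *)
  have k1 x : `|sech x ^+ 2| <= 8 * expR (- `|x|) :> R.
    rewrite (ger0_norm (s0 x)); apply: (le_trans (sech2_le_exp x)).
    by rewrite ler_wpM2r ?expR_ge0//; lra.
  have k2 x : `|- 2 * tanh x * sech x ^+ 2| <= 8 * expR (- `|x|) :> R.
    rewrite -mulrA normrM normrN (ger0_norm (ler0n R 2)); have := b1 x; lra.
  have [_ ->] := @is_derive_correlation V1 _ _ B 8 a mV1 V1B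
    (@is_derive_sech2 R) ck k1 k2.
  rewrite -[LHS]mulN1r -RintegralZl//; last first.
    apply: (@expdist_integrable_bound _ (B * 8) a).
      apply: measurable_funM => //.
      exact: (measurable_fun_shift a (continuous_measurable_fun ck)).
    by move=> t; rewrite normrM -[leRHS]mulrA; apply: ler_pM => //; exact: k2.
  rewrite -RintegralZl//; last first.
    apply: (@expdist_integrable_bound _ (B * 4) a).
      apply: measurable_funM => //.
      apply: (@measurable_fun_shift (fun x => tanh x * sech x ^+ 2)).
      by apply: measurable_funM => //; exact: continuous_measurable_fun.
    by move=> t; rewrite normrM -[leRHS]mulrA; apply: ler_pM.
  by apply: eq_Rintegral => y _; ring.
move: r0; rewrite p1 => /eqP; rewrite mulf_eq0 pnatr_eq0/= => /eqP ->; split => //.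
apply: contra r1 => /eqP I0; rewrite p1 derive1E.
have ck : continuous (fun x : R => sech x ^+ 2 * sech x ^+ 2 - 2 * tanh x ^+ 2 *
  sech x ^+ 2).
  move=> x; apply: cvgB; first by apply: cvgM; exact: c2.
  apply: cvgM; last exact: c2.
  apply: cvgM; first exact: cvg_cst.
  by rewrite expr2; apply: cvgM; exact: ct.
have k1 x : `|tanh x * sech x ^+ 2| <= 12 * expR (- `|x|) :> R.
  by apply: (le_trans (b1 x)); rewrite ler_wpM2r ?expR_ge0//; lra.
have k2 x : `|sech x ^+ 2 * sech x ^+ 2 - 2 * tanh x ^+ 2 * sech x ^+ 2|
    <= 12 * expR (- `|x|) :> R.
  have := sech2_le_exp x; have := sech2_le1 x; have := s0 x; have := tanh2 x.
  set p := sech x ^+ 2; set e := expR _; set t := tanh x ^+ 2 => -> p0 p1' pe.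
  rewrite ler_norml; apply/andP; split; nra.
have [D E] := @is_derive_correlation V1 _ _ B 12 s mV1 V1B
  (@is_derive_tanh_sech2 R) ck k1 k2.
have [_ ->] := is_derive_scale 2 (DeriveDef D E).
by rewrite I0 oppr0 mulr0.
Qed.

End potential_derivatives.

(** * Bounded measurable functions *)

Section bounded_measurable.
Context {R : realType}.
Implicit Types (f g : R -> R).

Definition bdd_mfun f := measurable_fun setT f /\ exists C, forall x, `|f x| <= C.

Lemma bdd_mfunD f g : bdd_mfun f -> bdd_mfun g -> bdd_mfun (fun x => f x + g x).
Proof.
move=> [mf [C fC]] [mg [D gD]]; split; first exact: measurable_funD.
by exists (C + D) => x; rewrite (le_trans (ler_normD _ _))// lerD.
Qed.

Lemma bdd_mfunM f g : bdd_mfun f -> bdd_mfun g -> bdd_mfun (fun x => f x * g x).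
Proof.
move=> [mf [C fC]] [mg [D gD]]; split; first exact: measurable_funM.
by exists (C * D) => x; rewrite normrM ler_pM.
Qed.

Lemma bdd_mfun_cst k : bdd_mfun (fun=> k).
Proof. by split => //; exists `|k|. Qed.

Lemma bdd_mfunZ k f : bdd_mfun f -> bdd_mfun (fun x => k * f x).
Proof. by apply: bdd_mfunM; exact: bdd_mfun_cst. Qed.

Lemma bdd_mfunB f g : bdd_mfun f -> bdd_mfun g -> bdd_mfun (fun x => f x - g x).
Proof.
move=> bf /(bdd_mfunZ (-1)) bg; have := bdd_mfunD bf bg.
by under eq_fun do rewrite mulN1r.
Qed.

Lemma bdd_mfunX n f : bdd_mfun f -> bdd_mfun (fun x => f x ^+ n).
Proof.
move=> bf; elim: n => [|n IH]; first exact: bdd_mfun_cst.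
by under eq_fun do rewrite exprS; exact: bdd_mfunM.
Qed.

Lemma bdd_mfun_locally f : bdd_mfun f -> locally_bounded f.
Proof. by move=> [_ [C fC]]; exact: bounded_locally fC. Qed.

Lemma Rintegral_subset_le (A B : set (measurableTypeR R)) f : measurable A ->
  measurable B -> A `<=` B -> (forall x, B x -> 0 <= f x) ->
  mu.-integrable B (EFin \o f) ->
  \int[mu]_(x in A) f x <= \int[mu]_(x in B) f x.
Proof.
move=> mA mB AB f0 fi.
have fiA := integrableS mB mA AB fi.
apply: fine_le; [exact: integrable_fin_num|exact: integrable_fin_num|].
apply: ge0_subset_integral => //; first exact: measurable_int fi.
Qed.

End bounded_measurable.

(** * The kink and its zero mode *)

Section zero_mode.
Context {R : realType}.
Variable s : R.

Definition kink (x : R) : R := tanh (x - s).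
Definition zero_mode (x : R) : R := sech (x - s) ^+ 2.

Lemma kink2 x : kink x ^+ 2 = 1 - zero_mode x.
Proof. exact: tanh2. Qed.

Lemma kink_le1 x : `|kink x| <= 1.
Proof. exact: tanh_le1. Qed.

Lemma zero_mode_gt0 x : 0 < zero_mode x.
Proof. by rewrite exprn_gt0// sech_gt0. Qed.

Lemma zero_mode_le1 x : zero_mode x <= 1.
Proof. exact: sech2_le1. Qed.

Lemma primitive_kink : primitive kink zero_mode.
Proof.
apply: primitive_C1 => x.
  apply: (@continuous_comp _ _ _ (fun x => x - s) (fun t => sech t ^+ 2)).
    by apply: cvgB; [exact: cvg_id|exact: cvg_cst].
  exact: continuous_sech2.
exact: (is_derive_recenter (is_derive_tanh (x - s))).
Qed.

Lemma continuous_kink : continuous kink.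
Proof. exact: primitive_continuous primitive_kink. Qed.

Lemma primitive_zero_mode :
  primitive zero_mode (fun x => - 2 * kink x * zero_mode x).
Proof.
have dz x : is_derive x (1 : R) zero_mode (- 2 * kink x * zero_mode x).
  exact: (is_derive_recenter (is_derive_sech2 (x - s))).
apply: primitive_C1 => // x.
apply: cvgM; last exact: is_derive_continuous dz x.
by apply: cvgM; [exact: cvg_cst|exact: continuous_kink].
Qed.

Lemma continuous_zero_mode : continuous zero_mode.
Proof. exact: primitive_continuous primitive_zero_mode. Qed.

Lemma bdd_mfun_kink : bdd_mfun kink.
Proof.
split; first exact: continuous_measurable_fun continuous_kink.
by exists 1; exact: kink_le1.
Qed.

Lemma bdd_mfun_zero_mode : bdd_mfun zero_mode.
Proof.
split; first exact: continuous_measurable_fun continuous_zero_mode.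
by exists 1 => x; rewrite ger0_norm ?zero_mode_le1// ltW// zero_mode_gt0.
Qed.

Lemma zero_mode_ge x : expR (- (2 * `|x - s|)) <= zero_mode x.
Proof. exact: sech2_ge. Qed.

Lemma zero_mode_le x : zero_mode x <= 4 * expR (- (2 * `|x - s|)).
Proof. exact: sech2_le. Qed.

Lemma zero_mode_inv x : (zero_mode x)^-1 <= expR (2 * `|x - s|).
Proof.
rewrite -[leRHS]invrK -expRN lef_pV2 ?posrE ?expR_gt0 ?zero_mode_gt0//.
exact: zero_mode_ge.
Qed.

Lemma primitive_zero_modeV :
  primitive (fun x => (zero_mode x)^-1) (fun x => 2 * kink x / zero_mode x).
Proof.
have z0 x : zero_mode x != 0 by rewrite gt_eqF// zero_mode_gt0.
have dz x : is_derive x (1 : R) zero_mode (- 2 * kink x * zero_mode x).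
  exact: (is_derive_recenter (is_derive_sech2 (x - s))).
have dV x : is_derive x (1 : R) (fun x => (zero_mode x)^-1) (2 * kink x / zero_mode x).
  have d := is_deriveV (z0 x) (dz x).
  apply: is_derive_eq; rewrite /GRing.scale/=.
  by field.
apply: primitive_C1 => // x.
apply: cvgM; last exact: is_derive_continuous dV x.
by apply: cvgM; [exact: cvg_cst|exact: continuous_kink].
Qed.

Lemma integrable_zero_modeM f : bdd_mfun f ->
  mu.-integrable setT (EFin \o (fun t => zero_mode t * f t)).
Proof.
move=> [mf [C fC]]; apply: (@expdist_integrable_bound _ _ (4 * C) s).
  by apply: measurable_funM => //; exact: bdd_mfun_zero_mode.1.
move=> t; rewrite normrM (ger0_norm (ltW (zero_mode_gt0 t))) [leRHS]mulrAC.
by apply: ler_pM => //; [exact: ltW (zero_mode_gt0 t)|exact: sech2_le_exp].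
Qed.

End zero_mode.

(** * The inverse of the linearized operator *)

Section green.
Context {R : realType}.
Variable s : R.
Implicit Types (f g : R -> R).
Local Notation psi := (zero_mode s).
Local Notation T := (kink s).

(** For y >= s the difference is the integral of psi f over (y, +oo), so that
    in both cases only the half line that avoids s enters.  The jump at s is
    the integral of psi f over the line. *)
Definition flux f (y : R) : R :=
  (if y < s then 0 else \int[mu]_t (psi t * f t)) -
  \int[mu]_(t in `]-oo, y]) (psi t * f t).

(** Reduction of order: for u = psi z, the equation - u'' + (4 - 6 psi) u = f
    is (psi^2 z')' = - psi f. *)
Definition flux_potential f : R -> R := oriented_integral s (fun y =>
  flux f y / psi y ^+ 2).

Definition green f (x : R) : R := psi x * flux_potential f x.

Definition dgreen f (x : R) : R :=
  - 2 * T x * psi x * flux_potential f x + flux f x / psi x.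

Lemma primitive_tail f : bdd_mfun f ->
  primitive (fun y => \int[mu]_(t in `]-oo, y]) (psi t * f t))
            (fun t => psi t * f t).
Proof.
move=> bf; have [mF CF] := bdd_mfunM (bdd_mfun_zero_mode s) bf.
have intf := integrable_zero_modeM s bf.
split => //; first exact: bdd_mfun_locally (conj mF CF).
move=> a b ab.
have := @Rintegral_itvB R (fun t => psi t * f t) -oo%O (BRight b) a.
rewrite Rintegral_itv_obnd_cbnd; last exact: integrableS intf.
by move=> -> //; exact: integrableS intf.
Qed.

Lemma flux_rightE f y : bdd_mfun f -> s <= y ->
  flux f y = \int[mu]_(t in `]y, +oo[) (psi t * f t).
Proof.
move=> bf sy; have intf := integrable_zero_modeM s bf.
rewrite /flux ltNge sy/= -set_itvNyy.
apply: Rintegral_itvB => //.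
by rewrite set_itvNyy.
Qed.

Lemma flux_leftE f y : y < s ->
  flux f y = - \int[mu]_(t in `]-oo, y]) (psi t * f t).
Proof. by move=> ys; rewrite /flux ys sub0r. Qed.

Lemma bdd_mfun_flux f : bdd_mfun f -> bdd_mfun (flux f).
Proof.
move=> bf; have intf := integrable_zero_modeM s bf.
have mtail := primitive_measurable (primitive_tail bf).
split.
  apply: measurable_funB => //.
  apply: measurable_fun_ifT => //.
  exact: measurable_fun_ltr.
exists (\int[mu]_t `|psi t * f t|) => y.
have tl (A : set (measurableTypeR R)) : measurable A ->
    `|\int[mu]_(t in A) (psi t * f t)| <= \int[mu]_t `|psi t * f t|.
  move=> mA; apply: (le_trans (le_normr_Rintegral mA _)).
    exact: integrableS intf.
  apply: Rintegral_subset_le => //.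
  exact: (integrable_norm intf).
have [ys|sy] := ltP y s.
  by rewrite flux_leftE// normrN tl.
by rewrite flux_rightE// tl.
Qed.

Lemma primitive_flux_potential f : bdd_mfun f ->
  primitive (flux_potential f) (fun y => flux f y / psi y ^+ 2).
Proof.
move=> bf; have bh := bdd_mfun_flux bf.
have pV := primitive_zero_modeV s.
have mV := primitive_measurable pV.
have lV := primitive_locally_bounded pV.
rewrite /flux_potential.
have -> : (fun y => flux f y / psi y ^+ 2) =
          (fun y => flux f y * ((psi y)^-1 * (psi y)^-1)).
  by apply/funext => y; rewrite -expr2 exprVn.
apply: primitive_oriented_integral.
  by apply: measurable_funM; [exact: bh.1|exact: measurable_funM].
by apply: locally_boundedM; [exact: bdd_mfun_locally|exact: locally_boundedM].
Qed.

(** The orthogonality of f to psi removes the jump of the flux at s. *)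
Lemma primitive_flux f : bdd_mfun f -> \int[mu]_t (psi t * f t) = 0 ->
  primitive (flux f) (fun t => - (psi t * f t)).
Proof.
move=> bf I0; have := primitiveZ (-1) (primitive_tail bf).
rewrite (_ : flux f = fun y => -1 * \int[mu]_(t in `]-oo, y]) (psi t * f t)).
  by move=> /eq_primitive; apply => t; rewrite mulN1r.
by apply/funext => y; rewrite /flux I0 if_same sub0r mulN1r.
Qed.

Lemma primitive_green f : bdd_mfun f -> primitive (green f) (dgreen f).
Proof.
move=> bf; have := primitiveM (primitive_zero_mode s) (primitive_flux_potential bf).
move=> /eq_primitive; apply => x; rewrite /dgreen; congr (_ + _).
by field; rewrite gt_eqF// zero_mode_gt0.
Qed.

(** This is the equation L u = f for u = green f.  The product rule gives the
    derivative of - 2 T psi z + flux / psi, and T^2 = 1 - psi identifies it. *)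
Lemma primitive_dgreen f : bdd_mfun f -> \int[mu]_t (psi t * f t) = 0 ->
  primitive (dgreen f) (fun x => (4 - 6 * psi x) * green f x - f x).
Proof.
move=> bf I0.
have pT := primitive_kink s; have pp := primitive_zero_mode s.
have pz := primitive_flux_potential bf.
have ph := primitive_flux bf I0.
have := primitiveD (primitiveM (primitiveM (primitiveZ (-2) pT) pp) pz)
                   (primitiveM ph (primitive_zero_modeV s)).
move=> /eq_primitive; apply => x; rewrite /green.
have p0 : psi x != 0 by rewrite gt_eqF// zero_mode_gt0.
have := kink2 s x; move: (T x) (psi x) p0 (flux_potential f x) (flux f x) (f x).
move=> t p p0 z h k t2.
have -> : p = 1 - t ^+ 2 by lra.
have {}p0 : 1 - t ^+ 2 != 0 by rewrite (_ : 1 - t ^+ 2 = p)//; lra.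
by field.
Qed.

Section bounds.
Variable m : R -> R.
Hypothesis m_gt0 : forall x, 0 < m x.
Hypothesis m_harnack : forall x y, m y <= expR `|x - y| * m x.

(** The form in which the source enters the estimates: it holds for
    |f| <= A m by exp_dominated_le, and also for f = V T, which is dominated
    by m only after averaging. *)
Definition exp_dominated f (A : R) :=
  forall y, \int[mu]_t (expR (- (2 * `|t - y|)) * `|f t|) <= A * m y.

Lemma integrable_expdistM f y : bdd_mfun f ->
  mu.-integrable setT (EFin \o (fun t => expR (- (2 * `|t - y|)) * `|f t|)).
Proof.
move=> [mf [C fC]]; apply: (@expdist_integrable_bound _ _ C y).
  apply: measurable_funM; last exact: measurableT_comp.
  apply: measurableT_comp => //; apply: measurableT_comp => //.
  apply: measurable_funM => //; apply: measurableT_comp => //.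
  exact: measurable_funB.
move=> t; rewrite normrM normr_id (ger0_norm (expR_ge0 _)) mulrC.
apply: ler_pM => //.
by rewrite ler_expR lerN2 mulrDl mul1r lerDl.
Qed.

(** One of the two factors exp(-|t - y|) absorbs the growth of m, the other
    one has integral 2. *)
Lemma exp_dominated_le f A : bdd_mfun f -> (forall x, `|f x| <= A * m x) ->
  exp_dominated f (2 * A).
Proof.
move=> bf fA y.
have A0 : 0 <= A by have := le_trans (normr_ge0 _) (fA 0); rewrite pmulr_lge0.
apply: (@le_trans _ _ (\int[mu]_t (A * m y * expR (- `|t - y|)))).
  apply: le_Rintegral => //; first exact: integrable_expdistM.
    by apply: integrable_scale => //; exact: integrable_expdist.
  move=> t _.
  have : expR (- (2 * `|t - y|)) * `|f t| <=
         expR (- (2 * `|t - y|)) * (A * (expR `|y - t| * m y)).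
    rewrite ler_wpM2l ?expR_ge0//; apply: (le_trans (fA t)).
    by rewrite ler_wpM2l.
  move=> /le_trans; apply.
  rewrite le_eqVlt; apply/orP; left; apply/eqP.
  transitivity (A * m y * (expR (- (2 * `|t - y|)) * expR `|y - t|)); first by ring.
  by congr (_ * _); rewrite -expRD; congr expR; rewrite (distrC y); ring.
rewrite RintegralZl//; last exact: integrable_expdist.
rewrite Rintegral_expdist; lra.
Qed.

(** Beyond y, on the side away from s, |t - s| = |t - y| + |y - s|, so the
    bound 4 exp(-2|t - s|) of psi factors. *)
Lemma flux_bound f A y : bdd_mfun f -> exp_dominated f A ->
  `|flux f y| <= 4 * expR (- (2 * `|y - s|)) * (A * m y).
Proof.
move=> bf fA; have intf := integrable_zero_modeM s bf.
(* both half lines at once: D lies beyond y as seen from s *)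
suff H (D : set (measurableTypeR R)) : measurable D ->
    (forall t, D t -> `|t - s| = `|t - y| + `|y - s|) ->
    `|\int[mu]_(t in D) (psi t * f t)| <= 4 * expR (- (2 * `|y - s|)) * (A * m y).
  have [ys|sy] := ltP y s.
    rewrite flux_leftE// normrN; apply: H => // t; rewrite /= in_itv/= => ty.
    rewrite !ler0_norm; lra.
  rewrite flux_rightE//; apply: H => // t; rewrite /= in_itv/= andbT => ty.
  rewrite !ger0_norm; lra.
move=> mD HD.
have Ig := integrable_expdistM y bf.
set g := (fun t => _) in Ig.
pose c := 4 * expR (- (2 * `|y - s|)).
have c0 : 0 <= c by rewrite mulr_ge0// expR_ge0.
have Icg : mu.-integrable setT (EFin \o (fun t => c * g t)) by exact: integrable_scale.
apply: (@le_trans _ _ (\int[mu]_(t in D) (c * g t))).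
  apply: (norm_Rintegral_le (g := fun t : measurableTypeR R => c * g t)) => //.
  - exact: integrable_measurable (integrableS _ _ _ intf).
  - move=> t Dt; rewrite normrM (ger0_norm (ltW (zero_mode_gt0 s t))).
    apply: (@le_trans _ _ (4 * expR (- (2 * `|t - s|)) * `|f t|)).
      by rewrite ler_wpM2r// zero_mode_le.
    rewrite (HD t Dt) mulrDr opprD expRD /c /g.
    by rewrite le_eqVlt; apply/orP; left; apply/eqP; ring.
  - exact: integrableS Icg.
apply: (@le_trans _ _ (\int[mu]_t (c * g t))).
  apply: Rintegral_subset_le => // t _.
  by rewrite mulr_ge0// mulr_ge0// expR_ge0.
rewrite RintegralZl//; apply: ler_wpM2l => //; exact: fA.
Qed.

(** Between s and x the integrand flux / psi^2 at y is at most
    4 A exp(2|y - s|) m(y) <= 4 A m(x) exp(|x - s|) exp(|y - s|), and the last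
    factor integrates to at most exp(|x - s|). *)
Lemma flux_potential_bound f A x : bdd_mfun f -> exp_dominated f A ->
  `|flux_potential f x| <= 4 * A * m x * expR (2 * `|x - s|).
Proof.
move=> bf fA.
have A0 : 0 <= A.
  have := fA 0; rewrite -(@pmulr_lge0 _ (m 0) A (m_gt0 0)); apply: le_trans.
  by apply: Rintegral_ge0 => t _; rewrite mulr_ge0// expR_ge0.
have [mg lg _] := primitive_flux_potential bf.
set g := fun y => _ in mg lg.
have gB y : `|x - s| = `|x - y| + `|y - s| ->
    `|g y| <= 4 * A * m x * expR `|x - s| * expR `|y - s|.
  move=> xys; rewrite /g normrM normfV normrX (ger0_norm (ltW (zero_mode_gt0 s y))).
  apply: (@le_trans _ _ (4 * expR (- (2 * `|y - s|)) * (A *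
    (expR `|x - y| * m x)) * expR (2 * `|y - s|) ^+ 2)).
    apply: ler_pM => //.
    - by rewrite invr_ge0 exprn_ge0// ltW// zero_mode_gt0.
    - apply: (le_trans (flux_bound y bf fA)); rewrite ler_wpM2l ?mulr_ge0 ?expR_ge0//.
      by rewrite ler_wpM2l.
    - rewrite -exprVn; apply: lerXn2r; rewrite ?nnegrE ?expR_ge0//;
        last exact: zero_mode_inv.
      by rewrite invr_ge0 ltW// zero_mode_gt0.
  rewrite xys expRD expr2.
  have -> : expR (2 * `|y - s|) = expR `|y - s| ^+ 2 by rewrite expRM_natl.
  rewrite expRN (_ : expR (2 * `|y - s|) = expR `|y - s| ^+ 2) ?expRM_natl//.
  rewrite le_eqVlt; apply/orP; left; apply/eqP; field.
  by rewrite gt_eqF// expR_gt0.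
pose K := 4 * A * m x * expR `|x - s|.
have K0 : 0 <= K by rewrite !mulr_ge0 ?expR_ge0// ltW.
have -> : 4 * A * m x * expR (2 * `|x - s|) = K * expR `|x - s|.
  by rewrite /K (_ : 2 * `|x - s| = `|x - s| + `|x - s|) ?expRD; ring.
rewrite /flux_potential /oriented_integral -/g.
have [sx|/ltW xs] := leP s x.
  rewrite (Rintegral_itv_empty _ sx) subr0.
  have d1 y : is_derive y (1 : R) (fun t => expR (t - s)) (expR (y - s)).
    exact: is_derive_recenter (is_derive_expR _).
  have pE : primitive (fun t => K * expR (t - s)) (fun t => K * expR (t - s)).
    by apply: primitiveZ; apply: primitive_C1 => //; exact: is_derive_continuous d1.
  have [mE lE E] := pE.
  apply: (@le_trans _ _ (\int[mu]_(t in `[s, x]) (K * expR (t - s)))).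
    apply: (norm_Rintegral_le (g := fun t : measurableTypeR R =>
      K * expR (t - s))) => //.
    - exact: measurable_funTS.
    - move=> t /=; rewrite in_itv/= => /andP[st tx].
      have e : `|t - s| = t - s by rewrite ger0_norm// subr_ge0.
      apply: (le_trans (gB t _)); last by rewrite e.
      by rewrite e !ger0_norm ?subr_ge0//; ring.
    - exact: itv_bounded_integrable.
  rewrite E// subrr expR0 mulr1 ger0_norm ?subr_ge0//; lra.
rewrite (Rintegral_itv_empty _ xs) sub0r normrN.
have d1 y : is_derive y (1 : R) (fun t => expR (s - t)) (- expR (s - y)).
  exact: is_derive_reflect (is_derive_expR _).
have pE : primitive (fun t => - K * expR (s - t)) (fun t => K * expR (s - t)).
  have := @primitiveZ R (- K) (fun t => expR (s - t)) (fun t => - expR (s - t)).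
  move=> H; apply: eq_primitive; first apply: H.
    apply: primitive_C1 => // y; apply: cvgN; exact: is_derive_continuous d1 y.
  by move=> t /=; ring.
have [mE lE E] := pE.
apply: (@le_trans _ _ (\int[mu]_(t in `[x, s]) (K * expR (s - t)))).
  apply: (norm_Rintegral_le (g := fun t : measurableTypeR R => K * expR (s - t))) => //.
  - exact: measurable_funTS.
  - move=> t /=; rewrite in_itv/= => /andP[st tx].
    have e : `|t - s| = s - t by rewrite ler0_norm ?subr_le0// opprB.
    apply: (le_trans (gB t _)); last by rewrite e.
    by rewrite e !ler0_norm ?subr_le0//; ring.
  - exact: itv_bounded_integrable.
rewrite E// subrr expR0 mulr1 ler0_norm ?subr_le0// opprB; lra.
Qed.

(** The decay of psi compensates the growth of the flux potential exactly. *)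
Lemma green_bound f A x : bdd_mfun f -> exp_dominated f A ->
  `|green f x| <= 16 * A * m x.
Proof.
move=> bf fA; rewrite /green normrM (ger0_norm (ltW (zero_mode_gt0 s x))).
apply: (@le_trans _ _ (4 * expR (- (2 * `|x - s|)) *
  (4 * A * m x * expR (2 * `|x - s|)))).
  apply: ler_pM => //; first exact: ltW (zero_mode_gt0 s x).
    exact: zero_mode_le.
  exact: flux_potential_bound.
rewrite expRN le_eqVlt; apply/orP; left; apply/eqP; field.
by rewrite gt_eqF// expR_gt0.
Qed.

Lemma dgreen_bound f A x : bdd_mfun f -> exp_dominated f A ->
  `|dgreen f x| <= 36 * A * m x.
Proof.
move=> bf fA.
have -> : dgreen f x = - 2 * T x * green f x + flux f x / psi x.
  by rewrite /dgreen /green; ring.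
apply: (le_trans (ler_normD _ _)).
have := green_bound x bf fA; have := kink_le1 s x => T1 gB.
have B1 : `|- 2 * T x * green f x| <= 2 * (16 * A * m x).
  rewrite (normrM (- 2 * T x)) (normrM (- 2)) normrN (ger0_norm
    (ler0n R 2)) -mulrA ler_wpM2l//.
  by rewrite -[leRHS]mul1r; apply: ler_pM.
have B2 : `|flux f x / psi x| <= 4 * A * m x.
  rewrite normrM normfV (ger0_norm (ltW (zero_mode_gt0 s x))).
  apply: (@le_trans _ _ (4 * expR (- (2 * `|x - s|)) *
    (A * m x) * expR (2 * `|x - s|))).
    apply: ler_pM => //; [by rewrite invr_ge0 ltW// zero_mode_gt0|exact:
      flux_bound|exact: zero_mode_inv].
  rewrite expRN le_eqVlt; apply/orP; left; apply/eqP; field.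
  by rewrite gt_eqF// expR_gt0.
lra.
Qed.

End bounds.

End green.

(** * The virial identity *)

Section virial.
Context {R : realType}.
Variable s : R.
Implicit Types (f g : R -> R).
Local Notation psi := (zero_mode s).
Local Notation T := (kink s).

Lemma exp_vanishing (F : R -> R) (C : R) :
  (forall x, `|F x| <= C * expR (- `|x - s|)) -> vanishing F.
Proof.
move=> FC e e0.
have C0 : 0 <= C.
  by have := le_trans (normr_ge0 _) (FC 0); rewrite pmulr_lge0 ?expR_gt0.
exists (`|s| + C / e) => x Nx; apply: (le_trans (FC x)).
have xs : C / e <= `|x - s| by have := lerB_dist x s; lra.
have E : 1 + `|x - s| <= expR `|x - s| by exact: expR_ge1Dx.
rewrite expRN ler_pdivrMr ?expR_gt0// -ler_pdivrMl// mulrC.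
by apply: (le_trans _ E); lra.
Qed.

(** The integrand is the derivative of - psi^3 / 6. *)
Lemma integral_kink_zero_mode3 : \int[mu]_t (psi t * (T t * psi t ^+ 2)) = 0.
Proof.
have p3 := primitiveM (primitive_zero_mode s)
  (primitiveM (primitive_zero_mode s) (primitive_zero_mode s)).
have pQ := primitiveZ (- 6^-1) p3.
apply: (@primitive_integral0 _ (fun x => - 6^-1 * (psi x * (psi x * psi x)))).
- by apply: eq_primitive pQ _ => x; field.
- apply: integrable_zero_modeM; apply: bdd_mfunM; first exact: bdd_mfun_kink.
  exact/bdd_mfunX/bdd_mfun_zero_mode.
- apply: (@exp_vanishing _ 4) => x.
  have p0 := zero_mode_gt0 s x; have p1 := zero_mode_le1 s x.
  have := sech2_le_exp (x - s); rewrite -/(zero_mode s x) => pe.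
  have q0 : 0 <= psi x * (psi x * psi x) by do 2 (apply: mulr_ge0;
    first exact: ltW); exact: ltW.
  rewrite mulNr normrN (normrM 6^-1) (ger0_norm q0) ger0_norm ?invr_ge0//.
  apply: le_trans pe.
  have : psi x * (psi x * psi x) <= psi x * (1 * 1).
    by apply: ler_wpM2l; [exact: ltW|apply: ler_pM => //; exact: ltW].
  lra.
Qed.

Lemma green_linear a f g x : bdd_mfun f -> bdd_mfun g ->
  green s (fun t => a * f t + g t) x = a * green s f x + green s g x.
Proof.
move=> bf bg.
have If := integrable_zero_modeM s bf; have Ig := integrable_zero_modeM s bg.
have IL (D : set (measurableTypeR R)) : measurable D ->
   \int[mu]_(t in D) (psi t * (a * f t + g t)) =
   a * \int[mu]_(t in D) (psi t * f t) + \int[mu]_(t in D) (psi t * g t).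
  move=> mD.
  have IfD : mu.-integrable D (EFin \o (fun t => psi t * f t)) by exact: integrableS If.
  have IgD : mu.-integrable D (EFin \o (fun t => psi t * g t)) by exact: integrableS Ig.
  rewrite -RintegralZl// -RintegralD//; last exact: integrable_scale.
  by apply: eq_Rintegral => t _; ring.
have fluxE y : flux s (fun t => a * f t + g t) y = a * flux s f y + flux s g y.
  rewrite /flux !IL//; case: ifP => _; ring.
have [mf lf _] := primitive_flux_potential s bf.
have [mg lg _] := primitive_flux_potential s bg.
have OL (p q : R) :
  \int[mu]_(t in `[p, q]) (flux s (fun t => a * f t + g t) t / psi t ^+ 2) =
  a * \int[mu]_(t in `[p, q]) (flux s f t / psi t ^+ 2) +
  \int[mu]_(t in `[p, q]) (flux s g t / psi t ^+ 2).
  have IfD := itv_bounded_integrable p q mf lf;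
    have IgD := itv_bounded_integrable p q mg lg.
  rewrite -RintegralZl// -RintegralD//; last exact: integrable_scale.
  by apply: eq_Rintegral => t _; rewrite fluxE; ring.
have split_linear (p b c e h : R) :
    p * (a * b + c - (a * e + h)) = a * (p * (b - e)) + p * (c - h) by ring.
by rewrite /green /flux_potential /oriented_integral !OL; exact: split_linear.
Qed.

Lemma bdd_mfun_green (m : R -> R) (M A : R) f :
  (forall x, 0 < m x) -> (forall x y, m y <= expR `|x - y| * m x) ->
  (forall x, m x <= M) ->
  bdd_mfun f -> exp_dominated m f A -> bdd_mfun (green s f).
Proof.
move=> m0 mH mM bf fA; split; first exact: primitive_measurable (primitive_green s bf).
exists (16 * `|A| * M) => x; apply: (le_trans (green_bound s m0 mH x bf fA)).
apply: (@le_trans _ _ (16 * `|A| * m x)).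
  by apply: ler_wpM2r; [exact: ltW|rewrite ler_wpM2l// ler_norm].
by apply: ler_wpM2l => //; rewrite mulr_ge0.
Qed.

(** With w = green f, the difference of the two integrands is the derivative of
    - 2 psi^2 w + 2 T flux, which vanishes at infinity. *)
Lemma virial_identity (m : R -> R) (M A : R) f :
  (forall x, 0 < m x) -> (forall x y, m y <= expR `|x - y| * m x) ->
  (forall x, m x <= M) ->
  bdd_mfun f -> exp_dominated m f A -> \int[mu]_t (psi t * f t) = 0 ->
  \int[mu]_t (psi t * (12 * T t * psi t * green s f t)) =
  \int[mu]_t (psi t * (2 * T t * f t)).
Proof.
move=> m0 mH mM bf fA I0.
have bG := bdd_mfun_green m0 mH mM bf fA.
have bT := bdd_mfun_kink s; have bp := bdd_mfun_zero_mode s.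
have b1 : bdd_mfun (fun t => 12 * T t * psi t * green s f t).
  by apply: bdd_mfunM => //; apply: bdd_mfunM => //; exact: bdd_mfunZ.
have b2 : bdd_mfun (fun t => 2 * T t * f t).
  by apply: bdd_mfunM => //; exact: bdd_mfunZ.
apply/eqP; rewrite -subr_eq0 -RintegralB//; [|exact: integrable_zero_modeM..].
apply/eqP.
have pp := primitive_zero_mode s; have pT := primitive_kink s.
have pw := primitive_green s bf; have ph := primitive_flux bf I0.
have pQ := primitiveD (primitiveZ (-2) (primitiveM (primitiveM pp pp) pw))
                      (primitiveZ 2 (primitiveM pT ph)).
apply: (@primitive_integral0 _ (fun x => -2 *
  (psi x * psi x * green s f x) + 2 * (T x * flux s f x))).
- apply: eq_primitive pQ _ => x; rewrite /dgreen /green.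
  by field; rewrite gt_eqF// zero_mode_gt0.
- have := integrable_zero_modeM s (bdd_mfunB b1 b2).
  by under eq_fun do rewrite mulrBr.
apply: (@exp_vanishing _ (4 * 2 * 16 * A * M + 2 * 4 * A * M)) => x.
have A0 : 0 <= A.
  have := fA 0; rewrite -(@pmulr_lge0 _ (m 0) A (m0 0)); apply: le_trans.
  by apply: Rintegral_ge0 => t _; rewrite mulr_ge0// expR_ge0.
have p0 := zero_mode_gt0 s x; have p1 := zero_mode_le1 s x.
have pe : psi x <= 4 * expR (- `|x - s|) := sech2_le_exp (x - s).
have gB := green_bound s m0 mH x bf fA; have hB := flux_bound s x bf fA.
have T1 := kink_le1 s x.
set E := expR (- `|x - s|) in pe *.
have E0 : 0 <= E by exact: expR_ge0.
apply: (le_trans (ler_normD _ _)); rewrite [leRHS]mulrDl; apply: lerD.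
  rewrite mulNr normrN (normrM 2) (normrM (psi x * psi x)) (normrM (psi x)).
  rewrite (ger0_norm (ltW p0)) (ger0_norm (ler0n R 2)).
  apply: (@le_trans _ _ (2 * (1 * (4 * E) * (16 * A * M)))); last first.
  by rewrite le_eqVlt; apply/orP; left; apply/eqP; ring.
  rewrite ler_wpM2l//; apply: ler_pM => //.
  - by rewrite mulr_ge0// ltW.
  - by apply: ler_pM => //; exact: ltW.
  - by apply: (le_trans gB); rewrite ler_wpM2l// mulr_ge0.
rewrite (normrM 2) (normrM (T x)) (ger0_norm (ler0n R 2)).
apply: (@le_trans _ _ (2 * (1 * (4 * E * (A * M))))); last first.
  by rewrite le_eqVlt; apply/orP; left; apply/eqP; ring.
rewrite ler_wpM2l//; apply: ler_pM => //; apply: (le_trans hB).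
apply: ler_pM.
- by apply: mulr_ge0 => //; exact: expR_ge0.
- by apply: mulr_ge0 => //; exact: ltW.
- by apply: ler_wpM2l => //; rewrite ler_expR lerN2 mulrDl mul1r lerDl.
- by apply: ler_wpM2l.
Qed.

End virial.

(** * The weight *)

Section weight.
Context {R : realType}.
Variables (s : R) (V : R -> R).
Hypothesis bV : bdd_mfun V.
Hypothesis V2 : mu.-integrable setT (EFin \o (fun x => V x ^+ 2)).

(** The second term keeps the weight positive and makes it dominate the zero
    mode. *)
Definition weight2 (y : R) : R :=
  \int[mu]_t (expR (- `|t - y|) * V t ^+ 2) + expR (- `|y - s|).

Definition weight (y : R) : R := Num.sqrt (weight2 y).

Let localized (z : R * R) : \bar R := (expR (- `|z.2 - z.1|) * V z.2 ^+ 2)%:E.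

Let measurable_localized : measurable_fun setT localized.
Proof.
apply/measurable_EFinP; apply: measurable_funM; last first.
  by apply: measurable_funX; apply: measurableT_comp => //; case: bV.
apply: measurableT_comp => //; apply: measurableT_comp => //.
by apply: measurableT_comp => //; apply: measurable_funB.
Qed.

Let localized_ge0 z : (0 <= localized z)%E.
Proof. by rewrite lee_fin mulr_ge0 ?expR_ge0// sqr_ge0. Qed.

Lemma integrable_expdist_sqr y :
  mu.-integrable setT (EFin \o (fun t => expR (- `|t - y|) * V t ^+ 2)).
Proof.
have [m2 _] := bdd_mfunX 2 bV.
apply: (dominated_integrable (g := fun t : measurableTypeR R => V t ^+ 2)) => //.
  apply: measurable_funM => //.
  exact: continuous_measurable_fun (@continuous_expdist _ y).
move=> t _; rewrite normrM (ger0_norm (expR_ge0 _)) (ger0_norm (sqr_ge0 _)).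
rewrite -[leRHS]mul1r; apply: ler_wpM2r; first exact: sqr_ge0.
by rewrite -expR0 ler_expR oppr_le0.
Qed.

Lemma weight2_ge y : expR (- `|y - s|) <= weight2 y.
Proof.
rewrite /weight2 lerDr; apply: Rintegral_ge0 => t _.
by rewrite mulr_ge0 ?expR_ge0// sqr_ge0.
Qed.

Lemma weight2_gt0 y : 0 < weight2 y.
Proof. by apply: lt_le_trans (weight2_ge y); exact: expR_gt0. Qed.

Lemma weight_gt0 y : 0 < weight y.
Proof. by rewrite sqrtr_gt0 weight2_gt0. Qed.

Lemma weight_sqr y : weight y ^+ 2 = weight2 y.
Proof. by rewrite sqr_sqrtr// ltW// weight2_gt0. Qed.

Lemma expdist_harnack (t x y : R) :
  expR (- `|t - y|) <= expR `|x - y| * expR (- `|t - x|).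
Proof. by rewrite -expRD ler_expR; have := ler_distD y t x; rewrite (distrC y x);
  lra. Qed.

Lemma weight2_harnack x y : weight2 y <= expR `|x - y| * weight2 x.
Proof.
rewrite /weight2 mulrDr; apply: lerD; last first.
  by rewrite (distrC y) (distrC x s); exact: expdist_harnack.
rewrite -RintegralZl//; last exact: integrable_expdist_sqr.
apply: le_Rintegral => //; first exact: integrable_expdist_sqr.
  by apply: integrable_scale => //; exact: integrable_expdist_sqr.
move=> t _; rewrite mulrA; apply: ler_wpM2r; first exact: sqr_ge0.
exact: expdist_harnack.
Qed.

(** The square of the weight satisfies the same inequality, inherited from its
    kernels by the triangle inequality. *)
Lemma weight_harnack x y : weight y <= expR `|x - y| * weight x.
Proof.
have e1 : 1 <= expR `|x - y| by rewrite -expR0 ler_expR.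
rewrite -(@ler_pXn2r _ 2)// ?nnegrE; last 2 first.
- exact: ltW (weight_gt0 y).
- by rewrite mulr_ge0 ?expR_ge0// ltW// weight_gt0.
rewrite exprMn !weight_sqr; apply: (le_trans (weight2_harnack x y)).
apply: ler_wpM2r; first exact: ltW (weight2_gt0 x).
by rewrite expr2 -[leLHS]mul1r; apply: ler_wpM2r => //; exact: expR_ge0.
Qed.

Lemma bdd_mfun_weight : bdd_mfun weight.
Proof.
have [mV [C VC]] := bV; split.
  apply: measurableT_comp; first exact: continuous_measurable_fun (@sqrt_continuous R).
  apply: measurable_funD; last first.
    exact: continuous_measurable_fun (@continuous_expdist _ s).
  have := measurable_fun_fubini_tonelli_F (m2 := mu) _
    measurable_localized localized_ge0.
  by move=> mI; apply: measurableT_comp mI.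
exists (1 + (2 * C ^+ 2 + 1)) => x; rewrite ger0_norm ?sqrtr_ge0//.
have h : weight2 x <= 2 * C ^+ 2 + 1.
  rewrite /weight2; apply: lerD; last by rewrite -expR0 ler_expR oppr_le0.
  have -> : 2 * C ^+ 2 = \int[mu]_t (C ^+ 2 * expR (- `|t - x|)).
    by rewrite RintegralZl ?Rintegral_expdist 1?mulrC//; exact: integrable_expdist.
  apply: le_Rintegral => //; first exact: integrable_expdist_sqr.
    by apply: integrable_scale => //; exact: integrable_expdist.
  move=> t _; rewrite mulrC; apply: ler_wpM2r; first exact: expR_ge0.
  rewrite -(real_normK (num_real (V t))); apply: lerXn2r; rewrite ?nnegrE//.
  exact: le_trans (VC t).
rewrite -weight_sqr in h; have := weight_gt0 x; nra.
Qed.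

(** By Tonelli's theorem the convolution of exp(-|.|) with V^2 has integral
    twice that of V^2. *)
Lemma integrable_weight_sqr :
  mu.-integrable setT (EFin \o (fun x => weight x ^+ 2)).
Proof.
under eq_fun do rewrite weight_sqr; rewrite /weight2.
apply: integrable_add => //; last exact: integrable_expdist.
have fin y : (\int[mu]_t (expR (- `|t - y|) * V t ^+ 2)%:E \is a fin_num)%E.
  by apply: integrable_fin_num => //; exact: integrable_expdist_sqr.
apply/integrableP; split.
  apply/measurable_EFinP.
  have := measurable_fun_fubini_tonelli_F (m2 := mu) _
    measurable_localized localized_ge0.
  by move=> mI; apply: measurableT_comp mI.
rewrite (eq_integral (fun y : measurableTypeR R =>
  \int[mu]_t (expR (- `|t - y|) * V t ^+ 2)%:E)%E); last first.
  move=> y _; rewrite /= ger0_norm; last first.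
    by apply: Rintegral_ge0 => t _; rewrite mulr_ge0 ?expR_ge0// sqr_ge0.
  by rewrite /Rintegral fineK.
rewrite (@fubini_tonelli _ _ _ _ _ mu mu _ measurable_localized localized_ge0).
have -> : (\int[mu]_t \int[mu]_y (expR (- `|t - y|) * V t ^+ 2)%:E =
    \int[mu]_t (2 * V t ^+ 2)%:E)%E.
  apply: eq_integral => t _.
  under eq_integral do rewrite mulrC EFinM.
  rewrite ge0_integralZl//; last 2 first.
  - apply/measurable_EFinP; under eq_fun do rewrite distrC.
    exact: continuous_measurable_fun (@continuous_expdist _ t).
  - by rewrite lee_fin sqr_ge0.
  under eq_integral do rewrite distrC.
  by rewrite integral_expdist -EFinM mulrC.
have := integrable_scale 2 measurableT V2.
move=> /integrableP[_]; apply: le_lt_trans.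
rewrite le_eqVlt; apply/orP; left; apply/eqP; apply: eq_integral => t _ /=.
by rewrite ger0_norm// mulr_ge0// sqr_ge0.
Qed.

Lemma zero_mode_le_weight x : zero_mode s x <= 4 * weight x.
Proof.
apply: (le_trans (zero_mode_le s x)); apply: ler_wpM2l => //.
rewrite -(@ler_pXn2r _ 2)// ?nnegrE ?expR_ge0//; last exact: ltW (weight_gt0 x).
rewrite weight_sqr; apply: le_trans (weight2_ge x).
rewrite -expRM_natl ler_expR; have := normr_ge0 (x - s); lra.
Qed.

(** Pointwise, |V| <= V^2 / (2 m(y)) + m(y) / 2; after integration against
    exp(-|t - y|) the first term gives at most m(y) / 2 and the second m(y). *)
Lemma exp_dominated_weight f : bdd_mfun f -> (forall x, `|f x| <= `|V x|) ->
  exp_dominated weight f 2.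
Proof.
move=> bf fV y.
have w0 := weight_gt0 y; have we := weight_sqr y; set w := weight y in w0 we *.
have w1 : w != 0 by rewrite gt_eqF.
apply: (@le_trans _ _ (\int[mu]_t ((2 * w)^-1 *
  (expR (- `|t - y|) * V t ^+ 2) + w / 2 * expR (- `|t - y|)))).
  apply: le_Rintegral => //; first exact: integrable_expdistM.
    apply: integrable_add => //; apply: integrable_scale => //.
      exact: integrable_expdist_sqr.
    exact: integrable_expdist.
  move=> t _; have E0 := expR_ge0 (- `|t - y|).
  apply: (@le_trans _ _ (expR (- `|t - y|) * `|V t|)).
    apply: ler_pM => //.
    by rewrite ler_expR lerN2 mulrDl mul1r lerDl.
  have -> : (2 * w)^-1 * (expR (- `|t - y|) * V t ^+ 2) + w / 2 * expR (- `|t - y|)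
    = expR (- `|t - y|) * ((2 * w)^-1 * (V t ^+ 2 + w ^+ 2)) by field.
  apply: ler_wpM2l => //; rewrite mulrC ler_pdivlMr ?mulr_gt0//.
  rewrite -(real_normK (num_real (V t))).
  have := sqr_ge0 (`|V t| - w); lra.
rewrite RintegralD//; last 2 first.
- by apply: integrable_scale => //; exact: integrable_expdist_sqr.
- by apply: integrable_scale => //; exact: integrable_expdist.
rewrite RintegralZl//; last exact: integrable_expdist.
rewrite RintegralZl//; last exact: integrable_expdist_sqr.
rewrite Rintegral_expdist.
have : \int[mu]_t (expR (- `|t - y|) * V t ^+ 2) <= w ^+ 2.
  by rewrite we /weight2 lerDl expR_ge0.
set I := \int[mu]_t _ => Iw.
have : (2 * w)^-1 * I <= (2 * w)^-1 * w ^+ 2.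
  by apply: ler_wpM2l => //; rewrite invr_ge0 mulr_ge0// ltW.
have -> : (2 * w)^-1 * w ^+ 2 = w / 2 by field.
lra.
Qed.

End weight.

(** * Picard iteration in a weighted sup norm *)

Section fixed_point.
Context {R : realType} (X : Type).
Variables (W : X -> R) (S : set (X -> R)) (F : (X -> R) -> X -> R).
Hypothesis W0 : forall x, 0 <= W x.
Hypothesis S0 : S (fun=> 0).
Hypothesis Slim : forall (u : nat -> X -> R) (f : X -> R), (forall n, S (u n)) ->
  (forall x, u n x @[n --> \oo] --> f x) -> S f.
Hypothesis FS : forall f, S f -> (forall x, `|f x| <= W x) ->
  S (F f) /\ forall x, `|F f x| <= W x.
Hypothesis Fcontr : forall f g d, 0 <= d -> S f -> S g ->
  (forall x, `|f x| <= W x) -> (forall x, `|g x| <= W x) ->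
  (forall x, `|f x - g x| <= d * W x) ->
  forall x, `|F f x - F g x| <= d / 2 * W x.

(** The iterates from 0 satisfy |u_(n+1) - u_n| <= 2^(-n) W, hence converge
    pointwise with |f - u_n| <= 2^(1-n) W, and this suffices to pass to the
    limit in the equation.  The set S carries what must survive pointwise
    limits, namely measurability. *)
Lemma weighted_fixed_point : exists f, [/\ S f, forall x, `|f x| <= W x &
  forall x, F f x = f x].
Proof.
pose u n := iter n F (fun=> 0).
have uS n : S (u n) /\ forall x, `|u n x| <= W x.
  elim: n => [|n [Sn Wn]]; last exact: FS.
  by split => // x; rewrite normr0.
pose q n : R := 2^-1 ^+ n.
have q0 n : 0 <= q n by rewrite exprn_ge0// invr_ge0.
have qS n : q n.+1 = q n / 2 by rewrite /q exprSr.
have step n x : `|u n.+1 x - u n x| <= q n * W x.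
  elim: n x => [|n IH] x.
    by rewrite /q expr0 mul1r /= subr0; exact: (uS 1%N).2.
  rewrite qS; exact: (Fcontr (q0 n) (uS n.+1).1 (uS n).1 (uS n.+1).2 (uS n).2).
(* geometric sum, in closed form so that the induction closes *)
have far n k x : `|u (n + k)%N x - u n x| <= 2 * q n * (1 - q k) * W x.
  elim: k => [|k IH].
    by rewrite addn0 subrr normr0 /q expr0 subrr mulr0 mul0r.
  rewrite addnS (_ : _ - _ = (u (n + k).+1 x - u (n + k)%N x) + (u
    (n + k)%N x - u n x)); last by ring.
  apply: (le_trans (ler_normD _ _)); apply: (le_trans (lerD (step _ _) IH)).
  rewrite (_ : q (n + k)%N = q n * q k) ?qS; last by rewrite /q exprD.
  rewrite le_eqVlt; apply/orP; left; apply/eqP; by field.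
have far2 n k x : (n <= k)%N -> `|u k x - u n x| <= 2 * q n * W x.
  move=> nk; rewrite -(subnKC nk); apply: (le_trans (far n _ x)).
  rewrite ler_wpM2r// ler_piMr// ?mulr_ge0//.
  by rewrite lerBlDr lerDl.
have small K e : 0 <= K -> 0 < e -> exists n, K * q n <= e.
  move=> K0 e0.
  have /cvgrPdist_le/(_ (e / (K + 1))) : q n @[n --> \oo] --> 0.
    by apply: cvg_expr; rewrite ger0_norm ?invr_ge0// invf_lt1// ltr1n.
  case=> [|N _ HN]; first by rewrite divr_gt0// ltr_wpDl.
  exists N; have := HN N (leqnn N); rewrite /= sub0r normrN (ger0_norm (q0 N)).
  rewrite ler_pdivlMr ?ltr_wpDl// => H; apply: le_trans H.
  by rewrite mulrC ler_wpM2l// lerDl.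
have cu x : cvg (u n x @[n --> \oo]).
  apply/cauchy_cvgP/cauchy_exP => e e0.
  have [N HN] := small (2 * W x) (e / 2) (mulr_ge0 (ler0n _ 2) (W0 x))
    (divr_gt0 e0 (ltr0n _ 2)).
  exists (u N x); exists N => // k Nk /=.
  rewrite /ball/= distrC; apply: (le_lt_trans (far2 _ _ x Nk)).
  rewrite mulrAC; apply: (le_lt_trans HN); lra.
pose f x := lim (u n x @[n --> \oo]).
have uf x : u n x @[n --> \oo] --> f x by exact: cu.
have Sf : S f by apply: (Slim _ uf) => n; exact: (uS n).1.
have fu n x : `|f x - u n x| <= 2 * q n * W x.
  have L : `|u k x - u n x| @[k --> \oo] --> `|f x - u n x|.
    by apply: cvg_norm; apply: cvgB; [exact: uf|exact: cvg_cst].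
  rewrite -(cvg_lim _ L)//; apply: limr_le; first by apply/cvg_ex; eexists; exact: L.
  by exists n => // k nk; exact: far2.
have fW x : `|f x| <= W x.
  rewrite -(cvg_lim _ (cvg_norm (uf x)))//; apply: limr_le.
    by apply/cvg_ex; eexists; exact: cvg_norm (uf x).
  by apply: nearW => n; exact: (uS n).2.
exists f; split => // x.
apply/eqP; rewrite -subr_eq0 -normr_le0; apply/ler_addgt0Pr => e e0; rewrite add0r.
have [n Hn] := small (2 * W x) e (mulr_ge0 (ler0n _ 2) (W0 x)) e0.
have H1 := Fcontr (mulr_ge0 (ler0n _ 2) (q0 n)) Sf (uS n).1 fW (uS n).2 (fu n) x.
have H2 := fu n.+1 x; rewrite qS in H2.
have -> : F f x - f x = (F f x - F (u n) x) - (f x - u n.+1 x) by rewrite /=; ring.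
apply: (le_trans (ler_normB _ _)); apply: (le_trans (lerD H1 H2)).
apply: le_trans Hn; rewrite le_eqVlt; apply/orP; left; apply/eqP; by field.
Qed.

End fixed_point.

(** * Bounds and Lipschitz bounds of polynomial expressions *)

Section close.
Context {R : realType}.
Implicit Types w d C D M x y : R.

(** Two values bounded by C w whose distance is at most C w d.  The weight w is
    1 or m(t), and d measures the distance of the two arguments from which the
    values are computed.  Taking d = 0 and x = y recovers plain bounds. *)
Definition close w d C x y :=
  [/\ `|x| <= C * w, `|y| <= C * w & `|x - y| <= C * w * d].

Lemma closeD w d C D x y x' y' : close w d C x y -> close w d D x' y' ->
  close w d (C + D) (x + x') (y + y').
Proof.
move=> [a b c] [a' b' c']; split.
- by rewrite mulrDl (le_trans (ler_normD _ _))// lerD.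
- by rewrite mulrDl (le_trans (ler_normD _ _))// lerD.
- by rewrite opprD addrACA !mulrDl (le_trans (ler_normD _ _))// lerD.
Qed.

(** x x' - y y' = x (x' - y') + (x - y) y'. *)
Lemma closeM w w' d C D x y x' y' : close w d C x y -> close w' d D x' y' ->
  close (w * w') d (2 * C * D) (x * x') (y * y').
Proof.
move=> [a b c] [a' b' c'].
have E : 2 * C * D * (w * w') = C * w * (D * w') + C * w * (D * w') by ring.
have H z z' : `|z| <= C * w -> `|z'| <= D * w' -> `|z * z'| <= 2 * C * D * (w * w').
  move=> zC zD; rewrite E normrM.
  have h : `|z| * `|z'| <= C * w * (D * w') by exact: ler_pM.
  have : 0 <= `|z| * `|z'| by exact: mulr_ge0.
  lra.
split; [exact: H|exact: H|].
have -> : x * x' - y * y' = x * (x' - y') + (x - y) * y' by ring.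
rewrite E (le_trans (ler_normD _ _))// !normrM.
have -> : (C * w * (D * w') + C * w * (D * w')) * d =
  C * w * (D * w' * d) + C * w * d * (D * w') by ring.
by apply: lerD; exact: ler_pM.
Qed.

Lemma closeMl w d C D x y x' y' : close 1 d C x y -> close w d D x' y' ->
  close w d (2 * C * D) (x * x') (y * y').
Proof. by move=> h h'; have := closeM h h'; rewrite mul1r. Qed.

Lemma close_le1 w d C M x y : 0 < w -> w <= M -> 0 <= d -> close w d C x y ->
  close 1 d (C * M) x y.
Proof.
move=> w0 wM d0 [a b c].
have C0 : 0 <= C by have := le_trans (normr_ge0 _) a; rewrite pmulr_lge0.
have CM : C * w <= C * M by rewrite ler_wpM2l.
split; rewrite mulr1; [exact: le_trans CM|exact: le_trans CM|].
by apply: (le_trans c); rewrite ler_wpM2r.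
Qed.

Lemma close_cst w d C x : 0 <= d -> `|x| <= C * w -> close w d C x x.
Proof.
move=> d0 xC; split => //; rewrite subrr normr0 mulr_ge0//.
exact: le_trans xC.
Qed.

Lemma close_num d k : 0 <= d -> close 1 d `|k| k k.
Proof. by move=> d0; apply: close_cst => //; rewrite mulr1. Qed.

End close.

(** * The nonlinear terms *)

Section reaction.
Context {R : realType}.
Variables (s : R) (V v : R -> R).
Local Notation psi := (zero_mode s).
Local Notation T := (kink s).
Implicit Types (b dl sg d t eps L : R) (r u : R -> R).

(** The term N(u) of the equation L u = - V T - eps N(u). *)
Definition reaction (eps : R) u t :=
  6 * T t * (u t * u t) + 2 * eps * (u t * (u t * u t)) + V t * u t.

Definition ansatz dl b r t := v t + b * psi t + dl * r t.

(** The part of N(ansatz) that carries a factor [dl]. *)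
Definition reaction_rest sg dl b r t :=
  6 * T t * (2 * (v t + b * psi t) * r t + dl * (r t * r t)) +
  2 * sg * dl * (ansatz dl b r t * (ansatz dl b r t * ansatz dl b r t)) +
  V t * r t.

Lemma reaction_expand sg dl b r t :
  reaction (sg * dl ^+ 2) (ansatz dl b r) t =
  (6 * T t * v t ^+ 2 + V t * v t) +
  b * (12 * T t * psi t * v t + V t * psi t) +
  6 * b ^+ 2 * (T t * psi t ^+ 2) + dl * reaction_rest sg dl b r t.
Proof. by rewrite /reaction_rest /reaction /ansatz; ring. Qed.

Section estimates.
Variables (m : R -> R) (M B Cv beta : R).
Hypothesis m_gt0 : forall x, 0 < m x.
Hypothesis m_le : forall x, m x <= M.
Hypothesis V_le : forall x, `|V x| <= B.
Hypothesis v_le : forall x, `|v x| <= Cv * m x.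
Hypothesis psi_le : forall x, psi x <= 4 * m x.

Let close_m d t C x y := @close_le1 R (m t) d C M x y (m_gt0 t) (m_le t).

Lemma close_v d t : 0 <= d -> close (m t) d Cv (v t) (v t).
Proof. by move=> d0; exact: close_cst. Qed.

Lemma close_psi d t : 0 <= d -> close (m t) d 4 (psi t) (psi t).
Proof.
by move=> d0; apply: close_cst => //; rewrite ger0_norm// ltW// zero_mode_gt0.
Qed.

Lemma close_kink d t : 0 <= d -> close 1 d 1 (T t) (T t).
Proof. by move=> d0; apply: close_cst => //; rewrite mulr1 kink_le1. Qed.

Lemma close_V d t : 0 <= d -> close 1 d B (V t) (V t).
Proof. by move=> d0; apply: close_cst => //; rewrite mulr1. Qed.

Lemma close_unit d x : 0 <= d -> `|x| <= 1 -> close 1 d 1 x x.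
Proof. by move=> d0 x1; apply: close_cst => //; rewrite mulr1. Qed.

(** The constant is found by the structure of the expression; only its
    independence of the point, of dl and of the arguments matters, here and in
    the next two lemmas. *)
Lemma close_ansatz : exists L, forall dl d b1 b2 r1 r2 t, 0 <= d -> `|dl| <= 1 ->
  close 1 d beta b1 b2 -> close (m t) d 1 (r1 t) (r2 t) ->
  close (m t) d L (ansatz dl b1 r1 t) (ansatz dl b2 r2 t).
Proof.
eexists => dl d b1 b2 r1 r2 t d0 dl1 bb rr.
apply: closeD; last by apply: closeMl; [exact: (close_unit d0 dl1)|exact: rr].
apply: closeD; first exact: close_v.
by apply: closeMl; [exact: bb|exact: close_psi].
Qed.

Lemma close_reaction : exists L, forall eps dl d b1 b2 r1 r2 t, 0 <= d ->
  `|dl| <= 1 -> `|eps| <= 1 ->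
  close 1 d beta b1 b2 -> close (m t) d 1 (r1 t) (r2 t) ->
  close (m t) d L (reaction eps (ansatz dl b1 r1) t)
                  (reaction eps (ansatz dl b2 r2) t).
Proof.
have [L HL] := close_ansatz.
eexists => eps dl d b1 b2 r1 r2 t d0 dl1 eps1 bb rr.
have cu := HL _ _ _ _ _ _ _ d0 dl1 bb rr; have cu1 := close_m d0 cu.
apply: closeD; [apply: closeD|].
- apply: closeMl; first by apply: closeMl; [exact: close_num|exact: close_kink].
  by apply: closeMl; [exact: cu1|exact: cu].
- apply: closeMl; first by apply: closeMl; [exact: close_num|exact:
    (close_unit d0 eps1)].
  by apply: closeMl; [exact: cu1|apply: closeMl; [exact: cu1|exact: cu]].
- by apply: closeMl; [exact: close_V|exact: cu].
Qed.

Lemma close_reaction_rest : exists L, forall sg dl d b1 b2 r1 r2 t, 0 <= d ->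
  `|dl| <= 1 -> `|sg| <= 1 ->
  close 1 d beta b1 b2 -> close (m t) d 1 (r1 t) (r2 t) ->
  close 1 d L (reaction_rest sg dl b1 r1 t) (reaction_rest sg dl b2 r2 t).
Proof.
have [L HL] := close_ansatz.
eexists => sg dl d b1 b2 r1 r2 t d0 dl1 sg1 bb rr.
have cu := close_m d0 (HL _ _ _ _ _ _ _ d0 dl1 bb rr).
have cr := close_m d0 rr.
have cp := close_m d0 (close_psi t d0).
have cv := close_m d0 (close_v t d0).
have c1 := close_unit d0 dl1.
apply: closeD; [apply: closeD|].
- apply: closeMl; first by apply: closeMl; [exact: close_num|exact: close_kink].
  apply: closeD; last by apply: closeMl; [exact: c1|apply: closeMl;
    [exact: cr|exact: cr]].
  apply: closeMl; last exact: cr.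
  apply: closeMl; first exact: close_num.
  by apply: closeD; [exact: cv|apply: closeMl; [exact: bb|exact: cp]].
- apply: closeMl; last by apply: closeMl; [exact: cu|apply: closeMl;
    [exact: cu|exact: cu]].
  apply: closeMl; last exact: c1.
  by apply: closeMl; [exact: close_num|exact: (close_unit d0 sg1)].
- by apply: closeMl; [exact: close_V|exact: cr].
Qed.

End estimates.

Lemma bdd_mfun_ansatz dl b r : bdd_mfun v -> bdd_mfun r -> bdd_mfun (ansatz dl b r).
Proof.
move=> bv br; apply: bdd_mfunD; last exact: bdd_mfunZ.
by apply: bdd_mfunD => //; apply: bdd_mfunZ; exact: bdd_mfun_zero_mode.
Qed.

Lemma bdd_mfun_reaction eps u : bdd_mfun V -> bdd_mfun u -> bdd_mfun (reaction eps u).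
Proof.
move=> bV bu; apply: bdd_mfunD; last exact: bdd_mfunM.
apply: bdd_mfunD; apply: bdd_mfunM.
- by apply: bdd_mfunZ; exact: bdd_mfun_kink.
- exact: bdd_mfunM.
- exact: bdd_mfun_cst.
- by apply: bdd_mfunM => //; exact: bdd_mfunM.
Qed.

Lemma bdd_mfun_reaction_rest sg dl b r : bdd_mfun V -> bdd_mfun v -> bdd_mfun r ->
  bdd_mfun (reaction_rest sg dl b r).
Proof.
move=> bV bv br; have ba := bdd_mfun_ansatz dl b bv br.
apply: bdd_mfunD; last exact: bdd_mfunM.
apply: bdd_mfunD; apply: bdd_mfunM.
- by apply: bdd_mfunZ; exact: bdd_mfun_kink.
- apply: bdd_mfunD; last by apply: bdd_mfunZ; exact: bdd_mfunM.
  apply: bdd_mfunM => //; apply: bdd_mfunZ; apply: bdd_mfunD => //.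
  by apply: bdd_mfunZ; exact: bdd_mfun_zero_mode.
- exact: bdd_mfun_cst.
- by apply: bdd_mfunM => //; exact: bdd_mfunM.
Qed.

End reaction.

(** * Solving the perturbed equation *)

Section solution.
Context {R : realType}.
Variables (s : R) (V : R -> R).
Hypothesis bV : bdd_mfun V.
Hypothesis V2 : mu.-integrable setT (EFin \o (fun x => V x ^+ 2)).
Local Notation psi := (zero_mode s).
Local Notation T := (kink s).
Local Notation m := (weight s V).
Hypothesis orth : \int[mu]_t (V t * (T t * psi t)) = 0.
Hypothesis nondeg :
  \int[mu]_t (V t * (psi t * psi t - 2 * T t ^+ 2 * psi t)) != 0.
Implicit Types (b dl sg d t x eps L : R) (f g r u : R -> R).

Definition pairing f := \int[mu]_t (psi t * f t).

Lemma pairingD f g : bdd_mfun f -> bdd_mfun g ->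
  pairing (fun t => f t + g t) = pairing f + pairing g.
Proof.
move=> bf bg; rewrite /pairing -RintegralD//; [|exact: integrable_zero_modeM..].
by apply: eq_Rintegral => t _; rewrite mulrDr.
Qed.

Lemma pairingZ k f : bdd_mfun f -> pairing (fun t => k * f t) = k * pairing f.
Proof.
move=> bf; rewrite /pairing -RintegralZl//; last exact: integrable_zero_modeM.
by apply: eq_Rintegral => t _; ring.
Qed.

Lemma pairing_le f C : bdd_mfun f -> (forall x, `|f x| <= C) ->
  `|pairing f| <= C * pairing (fun=> 1).
Proof.
move=> bf fC; rewrite -pairingZ; last exact: bdd_mfun_cst.
apply: (norm_Rintegral_le (g := fun t : measurableTypeR R => psi t * (C * 1))) => //.
- exact: integrable_measurable (integrable_zero_modeM s bf).
- move=> t _; rewrite normrM (ger0_norm (ltW (zero_mode_gt0 s t))) mulr1.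
  by apply: ler_wpM2l; [exact: ltW (zero_mode_gt0 s t)|].
- by apply: integrable_zero_modeM; exact: bdd_mfun_cst.
Qed.

Lemma exp_dominatedD (w : R -> R) f g A1 A2 : bdd_mfun f -> bdd_mfun g ->
  exp_dominated w f A1 -> exp_dominated w g A2 ->
  exp_dominated w (fun t => f t + g t) (A1 + A2).
Proof.
move=> bf bg fA gA y; rewrite mulrDl; apply: le_trans (lerD (fA y) (gA y)).
rewrite -RintegralD//; [|exact: integrable_expdistM..].
apply: le_Rintegral => //.
- by apply: integrable_expdistM; exact: bdd_mfunD.
- by apply: integrable_add => //; exact: integrable_expdistM.
- move=> t _; rewrite -mulrDr; apply: ler_wpM2l; first exact: expR_ge0.
  exact: ler_normD.
Qed.

Let m_gt0 := @weight_gt0 R s V.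
Let m_harnack := weight_harnack s bV V2.

Definition source t := - (V t * T t).
Definition first_order : R -> R := green s source.
Local Notation v := first_order.

Lemma bdd_mfun_source : bdd_mfun source.
Proof.
have := bdd_mfunZ (-1) (bdd_mfunM bV (bdd_mfun_kink s)).
by under eq_fun do rewrite mulN1r.
Qed.

(** The function V need not be bounded by a multiple of the weight, only its
    averages are. *)
Lemma source_dominated : exp_dominated m source 2.
Proof.
apply: exp_dominated_weight => // [|x]; first exact: bdd_mfun_source.
rewrite /source normrN normrM -[leRHS]mulr1; apply: ler_wpM2l => //.
exact: kink_le1.
Qed.

Lemma pairing_source : pairing source = 0.
Proof.
rewrite /pairing -[RHS]oppr0 -[in RHS]orth -[RHS]mulN1r -RintegralZl//.
  by apply: eq_Rintegral => t _; rewrite /source; ring.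
have := integrable_zero_modeM s (bdd_mfunM bV (bdd_mfun_kink s)).
by apply: eq_integrable => // t _ /=; congr EFin; ring.
Qed.

Lemma first_order_le x : `|v x| <= 32 * m x.
Proof.
have := green_bound s m_gt0 m_harnack x bdd_mfun_source source_dominated.
by rewrite (_ : 16 * 2 = 32 :> R)//; ring.
Qed.

Lemma weight_bounded : exists M, forall x, m x <= M.
Proof.
have [_ [M mM]] := bdd_mfun_weight s bV V2; exists M => x.
exact: le_trans (ler_norm _) (mM x).
Qed.

Lemma bdd_mfun_first_order : bdd_mfun v.
Proof.
have [M mM] := weight_bounded.
exact: (bdd_mfun_green s m_gt0 m_harnack mM bdd_mfun_source source_dominated).
Qed.

(** The coefficient of b in the solvability condition. *)
Definition slope := pairing (fun t => 12 * T t * psi t * v t + V t * psi t).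

(** The virial identity replaces 12 T psi v by 2 T source = - 2 T^2 V under the
    integral, which leaves the integral of V (T psi)'. *)
Lemma slope_neq0 : slope != 0.
Proof.
have [M mM] := weight_bounded.
have bT := bdd_mfun_kink s; have bp := bdd_mfun_zero_mode s.
have bs := bdd_mfun_source; have bv := bdd_mfun_first_order.
have b1 : bdd_mfun (fun t => 12 * T t * psi t * v t).
  by do 2 apply: bdd_mfunM => //; exact: bdd_mfunZ.
have b2 : bdd_mfun (fun t => V t * psi t) by exact: bdd_mfunM.
have b3 : bdd_mfun (fun t => 2 * T t * source t).
  by apply: bdd_mfunM => //; exact: bdd_mfunZ.
rewrite /slope pairingD//.
rewrite [X in X + _](virial_identity m_gt0 m_harnack mM bs source_dominated
  pairing_source).
rewrite -/(pairing (fun t => 2 * T t * source t)) -pairingD//.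
rewrite (_ : pairing _ = \int[mu]_t (V t * (psi t * psi t - 2 * T t ^+ 2 * psi t)))//.
by apply: eq_Rintegral => t _; rewrite /source; ring.
Qed.

Definition offset := pairing (fun t => 6 * T t * v t ^+ 2 + V t * v t).

(** The solvability condition is affine in b up to a term of size dl: the
    coefficient of b^2 is the integral of 6 T psi^3. *)
Lemma pairing_reaction sg dl b r : bdd_mfun r ->
  pairing (reaction s V (sg * dl ^+ 2) (ansatz s v dl b r)) =
  offset + slope * b + dl * pairing (reaction_rest s V v sg dl b r).
Proof.
move=> br.
have bT := bdd_mfun_kink s; have bp := bdd_mfun_zero_mode s;
  have bv := bdd_mfun_first_order.
have b6 : bdd_mfun (fun t => 6 * T t * v t ^+ 2 + V t * v t).
  apply: bdd_mfunD; last exact: bdd_mfunM.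
  by apply: bdd_mfunM; [exact: bdd_mfunZ|exact: bdd_mfunX].
have b12 : bdd_mfun (fun t => 12 * T t * psi t * v t + V t * psi t).
  apply: bdd_mfunD; last exact: bdd_mfunM.
  by do 2 apply: bdd_mfunM => //; exact: bdd_mfunZ.
have b3 : bdd_mfun (fun t => T t * psi t ^+ 2).
  by apply: bdd_mfunM => //; exact: bdd_mfunX.
have bR := bdd_mfun_reaction_rest s sg dl b bV bv br.
rewrite (_ : reaction _ _ _ _ = fun t => (6 * T t * v t ^+ 2 + V t * v t) +
  b * (12 * T t * psi t * v t + V t * psi t) +
  6 * b ^+ 2 * (T t * psi t ^+ 2) + dl * reaction_rest s V v sg dl b r t); last first.
  by apply/funext => t; exact: reaction_expand.
have b12' := bdd_mfunZ b b12; have b3' := bdd_mfunZ (6 * b ^+ 2) b3.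
have bR' := bdd_mfunZ dl bR; have bs1 := bdd_mfunD b6 b12';
  have bs2 := bdd_mfunD bs1 b3'.
rewrite pairingD// pairingD// pairingD// !pairingZ//.
rewrite {3}/pairing integral_kink_zero_mode3 mulr0 addr0 /offset /slope; ring.
Qed.


(** The unknown (b, r) is encoded as a function on [option R], with b at None,
    so that a single weighted sup norm measures both components: the weight is
    beta at None and m(x) at Some x.  The value beta = |offset / slope| + 1
    leaves room for a perturbation of size 1 of b = - offset / slope, the
    solution at dl = 0. *)
Lemma perturbed_solution : exists dl0 C, [/\ 0 < dl0, 0 < C &
  forall dl sg, 0 <= dl <= dl0 -> `|sg| <= 1 ->
  exists u u1 u2, [/\ primitive u u1, primitive u1 u2,
    forall x, u2 x = (4 - 6 * psi x) * u x + V x * T x +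
      sg * dl ^+ 2 * reaction s V (sg * dl ^+ 2) u x &
    forall x, [/\ `|u x| <= C * m x, `|u1 x| <= C * m x &
      `|u2 x| <= C * (m x + `|V x|)]]].
Proof.
have [M mM] := weight_bounded.
have [mV [B VB]] := bV.
have bv := bdd_mfun_first_order.
pose beta := `|offset / slope| + 1.
have beta1 : 1 <= beta by rewrite /beta lerDr.
have psi4 := zero_mode_le_weight s V.
have [LA HA] := @close_ansatz R s v m 32 beta first_order_le psi4.
have [LN HN] := @close_reaction R s V v m M B 32 beta m_gt0 mM VB first_order_le psi4.
have [LP HP] := @close_reaction_rest R s V v m M B 32 beta m_gt0 mM VB
  first_order_le psi4.
have close_self b r x : `|b| <= beta -> `|r x| <= m x ->
    close 1 0 beta b b /\ close (m x) 0 1 (r x) (r x).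
  by move=> bb rr; split; apply: close_cst; rewrite ?mulr1 ?mul1r.
have close00 : close 1 0 beta 0 0 /\ forall x, close (m x) 0 1 0 0.
  split => [|x]; apply: close_cst => //; rewrite normr0.
    by rewrite mulr1; lra.
  by rewrite mul1r; exact: ltW.
have e01 : `|0 : R| <= 1 by rewrite normr0.
have LN0 : 0 <= LN.
  have [h _ _] := HN _ _ _ _ _ (fun=> 0) (fun=>
    0) 0 (lexx _) e01 e01 close00.1 (close00.2 0).
  by have := le_trans (normr_ge0 _) h; rewrite pmulr_lge0.
have LP0 : 0 <= LP.
  have [h _ _] := HP _ _ _ _ _ (fun=> 0) (fun=>
    0) 0 (lexx _) e01 e01 close00.1 (close00.2 0).
  by have := le_trans (normr_ge0 _) h; rewrite mulr1.
have LA0 : 0 <= LA.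
  have [h _ _] := HA _ _ _ _ (fun=> 0) (fun=> 0) 0 (lexx _) e01 close00.1 (close00.2 0).
  by have := le_trans (normr_ge0 _) h; rewrite pmulr_lge0.
pose P1 := pairing (fun=> 1).
have P10 : 0 <= P1.
  by apply: Rintegral_ge0 => t _; rewrite mulr1; exact: ltW (zero_mode_gt0 s t).
have k0 := slope_neq0; have ak0 : 0 < `|slope| by rewrite normr_gt0.
pose Q := LP * P1 / `|slope|.
have Q0 : 0 <= Q by rewrite divr_ge0// mulr_ge0.
(* dl times 64 LN and dl times 2 Q must be at most 1, for r and for b *)
pose den := 64 * LN + 2 * Q + 1.
have den1 : 1 <= den by rewrite /den; lra.
pose C := 144 + 144 * LN + 8 * beta + 4 * LA.
exists den^-1, C; split.
- by rewrite invr_gt0; lra.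
- by rewrite /C; lra.
move=> dl sg /andP[dl0 dlD] sg1.
have dlden : dl * den <= 1 by rewrite -ler_pdivlMr ?div1r//; lra.
have dl1 : `|dl| <= 1.
  rewrite ger0_norm//; apply: le_trans dlden; rewrite -[leLHS]mulr1.
  exact: ler_wpM2l.
have dlLN : 64 * (dl * LN) <= 1.
  apply: le_trans dlden; rewrite /den; have := mulr_ge0 dl0 Q0; nra.
have dlQ : 2 * (dl * Q) <= 1.
  apply: le_trans dlden; rewrite /den; have := mulr_ge0 dl0 LN0; nra.
pose eps := sg * dl ^+ 2.
have eps1 : `|eps| <= 1.
  rewrite normrM normrX -[leRHS](mulr1 1); apply: ler_pM => //.
  by rewrite exprn_ile1.
have sd1 : `|sg * dl| <= dl.
  by rewrite normrM (ger0_norm dl0) -[leRHS]mul1r; apply: ler_wpM2r.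
pose N b r := reaction s V eps (ansatz s v dl b r).
pose rest b r := reaction_rest s V v sg dl b r.
pose Fb b r := - (offset + dl * pairing (rest b r)) / slope.
pose Gr b r := fun t => - (sg * dl) * N b r t.
pose X := option R.
pose W (o : X) := if o is Some x then m x else beta.
pose F (f : X -> R) (o : X) := if o is Some x
  then green s (Gr (f None) (f \o Some)) x else Fb (f None) (f \o Some).
have bounded_r r : measurable_fun setT r -> (forall x, `|r x| <= m x) -> bdd_mfun r.
  by move=> mr rm; split => //; exists M => x; exact: le_trans (rm x) (mM x).
have bN b r : bdd_mfun r -> bdd_mfun (N b r).
  by move=> br; apply: bdd_mfun_reaction => //; exact: bdd_mfun_ansatz.
have bG b r : bdd_mfun r -> bdd_mfun (Gr b r) by move=> br; apply: bdd_mfunZ; exact: bN.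
pose S := [set f : X -> R | measurable_fun setT (f \o Some)].
have [f [mf fW fF]] : exists f : X -> R, [/\ S f,
    forall o, `|f o| <= W o & forall o, F f o = f o].
  apply: (@weighted_fixed_point R X W S F).
  - by case=> [x|] /=; [exact: ltW|lra].
  - exact: measurable_cst.
  - move=> u f mu_ uf /=; apply: (measurable_fun_cvg (h := fun n => u n \o Some)) => //.
    by move=> x _; exact: uf.
  - move=> f mf fW; set r := f \o Some in mf *.
    have br : bdd_mfun r by apply: bounded_r => // x; exact: (fW (Some x)).
    have bNr := bN (f None) r br; have bGr := bG (f None) r br.
    split; first exact: primitive_measurable (primitive_green s bGr).
    have cs x := close_self (f None) r x (fW None) (fW (Some x)).
    case=> [x|] /=.
      have Gm t : `|Gr (f None) r t| <= (dl * LN) * m t.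
        have [h _ _] := HN _ _ _ _ _ r r t (lexx _) dl1 eps1 (cs t).1 (cs t).2.
        by rewrite /Gr normrM normrN -mulrA; apply: ler_pM.
      have := green_bound s m_gt0 m_harnack x bGr
        (exp_dominated_le m_gt0 m_harnack bGr Gm).
      move=> /le_trans; apply; rewrite -[leRHS]mul1r; apply: ler_wpM2r;
        first exact: ltW.
      have := mulr_ge0 dl0 LN0; lra.
    have Rm t : `|rest (f None) r t| <= LP.
      have [h _ _] := HP _ _ _ _ _ r r t (lexx _) dl1 sg1 (cs t).1 (cs t).2.
      by rewrite -[LP]mulr1.
    have pR := pairing_le (bdd_mfun_reaction_rest s sg dl (f None) bV bv br) Rm.
    have -> : Fb (f None) r = - (offset / slope) - dl *
      (pairing (rest (f None) r) / slope).
      by rewrite /Fb; field.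
    apply: (le_trans (ler_normB _ _)); rewrite normrN /beta; apply: lerD => //.
    rewrite normrM (ger0_norm dl0) normrM normfV.
    have : `|pairing (rest (f None) r)| / `|slope| <= Q.
      by rewrite /Q; apply: ler_wpM2r => //; rewrite invr_ge0.
    move=> /(ler_wpM2l dl0); have := mulr_ge0 dl0 Q0; lra.
  - move=> f g d d0 mf mg fW gW fg; set r1 := f \o Some in mf *;
      set r2 := g \o Some in mg *.
    have br1 : bdd_mfun r1 by apply: bounded_r => // x; exact: (fW (Some x)).
    have br2 : bdd_mfun r2 by apply: bounded_r => // x; exact: (gW (Some x)).
    have cb : close 1 d beta (f None) (g None).
      by split; rewrite mulr1; [exact: (fW None)|exact: (gW None)|rewrite mulrC;
        exact: (fg None)].
    have cr t : close (m t) d 1 (r1 t) (r2 t).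
      by split; rewrite mul1r; [exact: (fW (Some t))|exact:
        (gW (Some t))|rewrite mulrC; exact: (fg (Some t))].
    case=> [x|].
      have b1 := bG (f None) r1 br1; have b2 := bG (g None) r2 br2.
      rewrite /F /= -/r1 -/r2.
      have -> : green s (Gr (f None) r1) x - green s (Gr (g None) r2) x =
          green s (fun t => -1 * Gr (g None) r2 t + Gr (f None) r1 t) x.
        by rewrite green_linear// mulN1r addrC.
      have b12 := bdd_mfunD (bdd_mfunZ (-1) b2) b1.
      have Gm t : `|-1 * Gr (g None) r2 t + Gr (f None) r1 t| <= (dl * LN * d) * m t.
        have [_ _ h] := HN _ _ _ _ _ r1 r2 t d0 dl1 eps1 cb (cr t).
        rewrite /Gr (_ : _ + _ = - (sg * dl) * (N (f None) r1 t - N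
          (g None) r2 t)); last by ring.
        rewrite normrM normrN (_ : dl * LN * d * m t = dl * (LN * m t * d));
          last by ring.
        by apply: ler_pM.
      have := green_bound s m_gt0 m_harnack x b12
        (exp_dominated_le m_gt0 m_harnack b12 Gm).
      move=> /le_trans; apply; apply: ler_wpM2r; first exact: ltW.
      have := ler_wpM2r d0 dlLN; have := mulr_ge0 (mulr_ge0 dl0 LN0) d0; lra.
    rewrite /F -/r1 -/r2.
    have bR1 := bdd_mfun_reaction_rest s sg dl (f None) bV bv br1.
    have bR2 := bdd_mfun_reaction_rest s sg dl (g None) bV bv br2.
    have b12 := bdd_mfunD (bdd_mfunZ (-1) bR2) bR1.
    have Rm t : `|-1 * rest (g None) r2 t + rest (f None) r1 t| <= LP * d.
      have [_ _ h] := HP _ _ _ _ _ r1 r2 t d0 dl1 sg1 cb (cr t).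
      by rewrite mulN1r addrC -[LP]mulr1.
    have pR := pairing_le b12 Rm.
    rewrite pairingD ?pairingZ// in pR; last exact: bdd_mfunZ.
    have -> : Fb (f None) r1 - Fb (g None) r2 =
      - (dl * ((-1 * pairing (rest (g None) r2) + pairing (rest (f None) r1)) / slope)).
      by rewrite /Fb; field.
    rewrite normrN normrM (ger0_norm dl0) normrM normfV.
    have H : `|-1 * pairing (rest (g None) r2) + pairing (rest
      (f None) r1)| / `|slope| <= Q * d.
      rewrite /Q (_ : LP * P1 / `|slope| * d = LP * d * P1 / `|slope|); last by ring.
      by apply: ler_wpM2r => //; rewrite invr_ge0.
    apply: (le_trans (ler_wpM2l dl0 H)).
    apply: (@le_trans _ _ (d / 2 * 1)).
      have := ler_wpM2r d0 dlQ; lra.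
    by apply: ler_wpM2l => //; rewrite divr_ge0.
set b := f None in fF; set r := f \o Some in mf fF.
have br : bdd_mfun r by apply: bounded_r => // x; exact: (fW (Some x)).
have bEq : Fb b r = b := fF None.
have rEq x : green s (Gr b r) x = r x := fF (Some x).
have bNr := bN b r br; have bGr := bG b r br.
have cs x := close_self b r x (fW None) (fW (Some x)).
have projN : pairing (N b r) = 0.
  (* solvability is the fixed point equation for b multiplied by slope *)
  rewrite /N pairing_reaction// -/(rest b r) -[X in slope * X]bEq /Fb; field.
  exact: k0.
(* the complete right side - V T - eps N(u), now orthogonal to psi *)
pose ft t := dl * Gr b r t + source t.
have bft : bdd_mfun ft := bdd_mfunD (bdd_mfunZ dl bGr) bdd_mfun_source.
have proj_ft : pairing ft = 0.
  rewrite /ft pairingD ?pairingZ//; [|exact: bdd_mfunZ|exact: bdd_mfun_source].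
  by rewrite projN pairing_source !mulr0 addr0.
have greenE x : green s ft x = dl * r x + v x.
  by rewrite /ft green_linear ?rEq//; exact: bdd_mfun_source.
have NL t : `|N b r t| <= LN * m t.
  by have [h _ _] := HN _ _ _ _ _ r r t (lexx _) dl1 eps1 (cs t).1 (cs t).2.
have ftE t : ft t = - (eps * N b r t) - V t * T t.
  by rewrite /ft /Gr /source /eps; ring.
have epsN t : `|eps * N b r t| <= LN * m t.
  by rewrite normrM -[leRHS]mul1r; apply: ler_pM.
have dom_ft : exp_dominated m ft (2 * LN + 2).
  apply: exp_dominatedD; [exact: bdd_mfunZ|exact: bdd_mfun_source| |exact:
    source_dominated].
  apply: (exp_dominated_le m_gt0 m_harnack); first exact: bdd_mfunZ.
  move=> t; rewrite (_ : dl * _ = - (eps * N b r t)) ?normrN//.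
  by rewrite /Gr /eps; ring.
have uE x : ansatz s v dl b r x = b * psi x + green s ft x.
  by rewrite greenE /ansatz; ring.
pose u1 x := b * (- 2 * T x * psi x) + dgreen s ft x.
pose u2 x := b * ((4 - 6 * psi x) * psi x) + ((4 - 6 * psi x) * green s ft x - ft x).
have pp := primitive_zero_mode s.
have pp1 : primitive (fun x => - 2 * T x * psi x) (fun x => (4 - 6 * psi x) * psi x).
  have := primitiveM (primitiveZ (-2) (primitive_kink s)) pp.
  move=> /eq_primitive; apply => x.
  transitivity (- 2 * psi x * psi x + 4 * T x ^+ 2 * psi x); first by ring.
  by rewrite kink2; ring.
exists (ansatz s v dl b r), u1, u2.
have u2E x : u2 x = (4 - 6 * psi x) * ansatz s v dl b r x + V x * T x + eps * N b r x.
  by rewrite /u2 ftE uE; ring.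
have uB x : `|ansatz s v dl b r x| <= LA * m x.
  by have [h _ _] := HA _ _ _ _ r r x (lexx _) dl1 (cs x).1 (cs x).2.
split.
- rewrite (_ : ansatz s v dl b r = fun x => b * psi x + green s ft x);
    last exact/funext.
  exact: primitiveD (primitiveZ b pp) (primitive_green s bft).
- exact: primitiveD (primitiveZ b pp1) (primitive_dgreen bft proj_ft).
- exact: u2E.
move=> x; have mx := m_gt0 x; have bb : `|b| <= beta := fW None.
have p0 := zero_mode_gt0 s x; have p1 := zero_mode_le1 s x.
have TV : `|V x * T x| <= `|V x|.
  by rewrite normrM -[leRHS]mulr1; apply: ler_wpM2l => //; exact: kink_le1.
split.
- apply: (le_trans (uB x)); apply: ler_wpM2r; first exact: ltW.
  by rewrite /C; lra.
- apply: (le_trans (ler_normD _ _)).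
  have h1 := dgreen_bound s m_gt0 m_harnack x bft dom_ft.
  have h2 : `|b * (- 2 * T x * psi x)| <= beta * (8 * m x).
    rewrite normrM; apply: ler_pM => //.
    rewrite normrM normrM normrN (ger0_norm (ler0n R 2)) (ger0_norm (ltW p0)).
    rewrite (_ : 8 * m x = 2 * 1 * (4 * m x)); last by ring.
    by apply: ler_pM => //; [exact: ltW|apply: ler_pM => //; exact: kink_le1].
  apply: (le_trans (lerD h2 h1)); rewrite mulrA -mulrDl.
  by apply: ler_wpM2r; [exact: ltW|rewrite /C; lra].
- rewrite u2E; apply: (le_trans (ler_normD _ _)).
  apply: (le_trans (lerD (ler_normD _ _) (epsN x))).
  have h1 : `|(4 - 6 * psi x) * ansatz s v dl b r x| <= 4 * (LA * m x).
    by rewrite normrM; apply: ler_pM => //; rewrite ler_norml; lra.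
  have : (4 * LA + LN) * m x <= C * m x.
    by apply: ler_wpM2r; [exact: ltW|rewrite /C; lra].
  have : 1 * `|V x| <= C * `|V x|.
    by apply: ler_wpM2r => //; rewrite /C; lra.
  lra.
Qed.

End solution.

(** * Norms and the proof of the theorem *)

Section assembly.
Context {R : realType}.
Implicit Types (f g : R -> R).

Lemma Lfun_measurable f (p : \bar R) : f \in Lfun mu p -> measurable_fun setT f.
Proof. by rewrite inE => /andP[]; rewrite inE. Qed.

Lemma Lfunoo_ae_bounded f : f \in Lfun mu +oo%E ->
  exists B, {ae mu, forall x, `|f x| <= B}.
Proof.
move=> fL; have : (Lnorm mu +oo (EFin \o f) < +oo)%E.
  by move: fL; rewrite inE => /andP[_]; rewrite inE.
rewrite unlock ifT; last first.
  have := @lebesgue_measure_itv R `]-oo, +oo[%R; rewrite set_itvNyy/= => H.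
  by rewrite addye// in H; apply: (@lt_le_trans _ _ +oo%E) => //; rewrite -H.
move=> h; have [B HB] : exists B : R, (ess_sup mu (abse \o (EFin \o f)) <= B%:E)%E.
  move: h; case: (ess_sup _ _) => [r||] // _; first by exists r.
  by exists 0; rewrite leNye.
exists B; move/ess_supP : HB => HB.
apply: negligibleS HB => x /=.
by apply: contra_not; rewrite lee_fin.
Qed.

(** Membership in L^2 and the squared norm bound both come from the pointwise
    domination. *)
Lemma Lfun2_dominated f g k : measurable_fun setT f ->
  (forall x, `|f x| <= k * g x) ->
  mu.-integrable setT (EFin \o (fun x => g x ^+ 2)) ->
  f \in Lfun mu 2%:E /\
  ('N[mu]_2%:E[EFin \o f] `^ 2 <= (k ^+ 2 * \int[mu]_x g x ^+ 2)%:E)%E.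
Proof.
move=> mf fg g2.
have fg2 x : `|f x| ^+ 2 <= k ^+ 2 * g x ^+ 2.
  by rewrite -exprMn; apply: lerXn2r; rewrite ?nnegrE// (le_trans _ (fg x)).
have ig : mu.-integrable setT (EFin \o (fun x => k ^+ 2 * g x ^+ 2)).
  exact: integrable_scale.
have N2 : ('N[mu]_2%:E[EFin \o f] `^ 2 <= (k ^+ 2 * \int[mu]_x g x ^+ 2)%:E)%E.
  rewrite poweR_Lnorm// -RintegralZl// /Rintegral fineK; last exact: integrable_fin_num.
  rewrite (eq_integral (fun x : measurableTypeR R => (`|f x| ^+ 2)%:E)); last first.
    by move=> x _; rewrite /= powR_mulrn.
  apply: ge0_le_integral => //=.
  - by apply/measurable_EFinP; apply: measurable_funX; exact: measurableT_comp.
  - exact: measurable_int ig.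
  - by move=> x _; rewrite lee_fin; exact: fg2.
split => //.
rewrite inE; apply/andP; split; rewrite inE//=.
apply: (@lty_poweRy _ _ 2%R) => //.
exact: le_lt_trans N2 (ltry _).
Qed.

End assembly.

Theorem lemma7p1 (R : realType) (V : R -> R) (s : R)
    (V_W2oo : sobolev 2 +oo%E V)
    (V_L2 : V \in Lfun lebesgue_measure 2%:E)
    (s_root : simple_root (effective_potential V)^`() s) :
  exists eps0 C : R,
    [/\ 0 < eps0, 0 < C &
      forall eps : R, - eps0 < eps < eps0 ->
        exists phi w : R -> R,
          [/\ phi = (fun x => tanh (x - s) + w x),
              sobolev 2 2%:E w,
              (Hnorm 2 w <= (C * `|eps|)%:E)%E &
              stationary_solution V eps phi]].
Proof.
have [D [D0 DV]] := V_W2oo.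
have [VLoo _] := DV 0%N isT; rewrite D0 in VLoo.
have mV := Lfun_measurable VLoo.
have [B VB] := Lfunoo_ae_bounded VLoo.
(* a bounded representative of V *)
pose V1 x := if `|V x| <= B then V x else 0.
have mV1 : measurable_fun setT V1.
  apply: measurable_fun_ifT => //.
  by apply: measurable_fun_ler => //; exact: measurableT_comp.
have V1V x : `|V1 x| <= `|V x| by rewrite /V1; case: ifP => // _; rewrite normr0.
have V1B x : `|V1 x| <= `|B|.
  by rewrite /V1; case: ifP => [h|_]; [exact: le_trans h (ler_norm _)|rewrite normr0].
have VV1 : {ae lebesgue_measure, forall x, V x = V1 x}.
  apply: negligibleS VB => x /=; apply: contra_not => VBx.
  by rewrite /V1 VBx.
have [orth nondeg] := simple_root_integrals mV mV1 VV1 V1B s_root.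
have bV1 : bdd_mfun V1 by split => //; exists `|B|.
have V2 : lebesgue_measure.-integrable setT (EFin \o (fun x => V1 x ^+ 2)).
  apply: (dominated_integrable (g := fun x : measurableTypeR R => V x ^+ 2)) => //.
  - exact: measurable_funX.
  - move=> x _; rewrite normrX -(real_normK (num_real (V x))).
    by apply: lerXn2r; rewrite ?nnegrE.
  - exact: Lfun2_integrable_sqr.
have [dl0 [C [dl0_gt0 C_gt0 sol]]] := perturbed_solution bV1 V2 orth nondeg.
(* a common square integrable bound for u, u' and u'' *)
pose q x := weight s V1 x + `|V1 x|.
have mq : measurable_fun setT q.
  apply: measurable_funD; last exact: measurableT_comp.
  exact: (bdd_mfun_weight s bV1 V2).1.
have q2 : lebesgue_measure.-integrable setT (EFin \o (fun x => q x ^+ 2)).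
  apply: (dominated_integrable (g := fun x : measurableTypeR R =>
    2 * weight s V1 x ^+ 2 + 2 * V1 x ^+ 2)) => //.
  - exact: measurable_funX.
  - move=> x _; rewrite ger0_norm ?sqr_ge0// -(real_normK (num_real (V1 x))).
    have := sqr_ge0 (weight s V1 x - `|V1 x|); rewrite /q; nra.
  - by apply: integrable_add => //; apply: integrable_scale => //;
      exact: integrable_weight_sqr.
pose I := \int[lebesgue_measure]_x q x ^+ 2.
have I0 : 0 <= I by apply: Rintegral_ge0 => x _; exact: sqr_ge0.
pose C1 := C * Num.sqrt (3 * I) + 1.
have C10 : 0 < C1 by rewrite ltr_wpDl// mulr_ge0 ?sqrtr_ge0// ltW.
exists (dl0 ^+ 2), C1; split => //; first by rewrite exprn_gt0.
move=> eps /andP[epsN epsP].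
(* eps = sg dl^2, with sg the sign of eps *)
pose dl := Num.sqrt `|eps|.
have dl2 : dl ^+ 2 = `|eps| by rewrite sqr_sqrtr.
have dlle : 0 <= dl <= dl0.
  rewrite sqrtr_ge0/= -(ger0_norm (ltW dl0_gt0)) -sqrtr_sqr; apply: ler_wsqrtr.
  by apply: ltW; rewrite ltr_norml epsN.
have sg1 : `|Num.sg eps| <= 1 by rewrite normr_sg lern1; case: (eps == 0).
have [u [u1 [u2 [pu pu1 u2E uB]]]] := sol dl (Num.sg eps) dlle sg1.
have epsE : Num.sg eps * dl ^+ 2 = eps by rewrite dl2 -numEsg.
rewrite epsE in u2E.
pose J k : R -> R := match k with 0 => fun x => eps * u x | 1 => fun x => eps * u1 x
  | 2 => fun x => eps * u2 x | _ => fun=> 0 end.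
have p0 : primitive (J 0%N) (J 1%N) := primitiveZ eps pu.
have p1 : primitive (J 1%N) (J 2%N) := primitiveZ eps pu1.
have JB k x : (k <= 2)%N -> `|J k x| <= (`|eps| * C) * q x.
  have [h0 h1 h2] := uB x; have w0 := weight_gt0 s V1 x.
  have qC : C * weight s V1 x <= C * q x.
    by apply: ler_wpM2l; [exact: ltW|rewrite /q lerDl].
  case: k => [|[|[|//]]] _ /=; rewrite normrM -mulrA; apply: ler_wpM2l => //.
  - exact: le_trans qC.
  - exact: le_trans qC.
have mJ k : (k <= 2)%N -> measurable_fun setT (J k).
  case: k => [|[|[|//]]] _.
  - exact: primitive_measurable p0.
  - by have [] := p0.
  - by have [] := p1.
have LJ k (k2 : (k <= 2)%N) := Lfun2_dominated (mJ k k2) (fun x => JB k x k2) q2.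
have jet : weak_jet 2 2%:E (J 0%N) J.
  split => // k k2; split; first exact: (LJ k k2).1.
  case: k k2 => [|[|[|//]]] k2.
  - apply: weak_derivative0; first exact: primitive_measurable p0.
    exact: primitive_locally_bounded p0.
  - exact: weak_derivative1.
  - exact: weak_derivative2 p0 p1.
exists (fun x => tanh (x - s) + J 0%N x), (J 0%N); split => //.
- by exists J.
- have E0 : 0 <= 3 * ((`|eps| * C) ^+ 2 * I).
    exact: mulr_ge0 (ler0n _ 3) (mulr_ge0 (sqr_ge0 _) I0).
  apply: (@le_trans _ _ ((\sum_(k < 3) 'N[lebesgue_measure]_2%:E[EFin \o J k]
    `^ 2) `^ 2^-1)%E).
    by apply: ereal_inf_lbound; exists J.
  apply: (@le_trans _ _ (((3 * ((`|eps| * C) ^+ 2 * I))%:E) `^ 2^-1)%E).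
    apply: gt0_ler_poweR => //.
    + by rewrite in_itv/= leey andbT; apply: sume_ge0 => k _; exact: poweR_ge0.
    + by rewrite in_itv/= leey andbT lee_fin.
    + apply: (@le_trans _ _ (\sum_(k < 3) ((`|eps| * C) ^+ 2 * I)%:E)%E).
        by apply: lee_sum => k _; apply: (LJ k _).2; rewrite -ltnS.
      rewrite sumEFin lee_fin sumr_const card_ord -mulr_natl; lra.
  rewrite poweR_EFin lee_fin powR12_sqrt//.
  rewrite (_ : 3 * _ = (`|eps| * C) ^+ 2 * (3 * I)); last by ring.
  rewrite sqrtrM ?sqr_ge0// sqrtr_sqr ger0_norm; last by rewrite mulr_ge0// ltW.
  rewrite /C1 (_ : (_ + 1) * _ = `|eps| * C * Num.sqrt (3 * I) + `|eps|).
    by rewrite lerDl.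
  by ring.
- have pk := primitive_kink s; have pp := primitive_zero_mode s.
  exists (fun x => - 2 * kink s x * zero_mode s x + J 2%N x).
    exact: weak_derivative2 (primitiveD pk p0) (primitiveD pp p1).
  apply: negligibleS VV1 => x /=; apply: contra_not => Vx.
  rewrite Vx real_normK ?num_real// u2E -/(kink s x) /reaction.
  rewrite (_ : zero_mode s x = 1 - kink s x ^+ 2); last by rewrite kink2; ring.
  by ring.
Qed.
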